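(* Fix a positive integer $q$, a constant $w\in[0,1]$, and real numbers $\delta\in(0,\infty)$, $\beta\in(-\infty,1]$. Consider a sequence of multivariate allometric regression models as described in the context, along which $n$ and $p$ tend to $\infty$ in such a way that $n/p^{\delta}$ converges to a finite positive value, with $q$ held fixed, and such that (i) $\|\boldsymbol{X}\boldsymbol{\alpha}\|^2=\Theta(p^{\delta})$; (ii) $\mathrm{tr}(\boldsymbol{\Sigma})=\Theta(p)$ and $\lambda_1-\lambda_2=\Theta(p^{\beta})$. Then \[ \min_{\theta\in\{-1,1\}} \| \theta\hat{\boldsymbol{\gamma}}_1(w)-\boldsymbol{\gamma}_1\| \to 0 \quad\text{in probability} \] holds under the following sufficient conditions: - for $w=0$: $\delta>1$; - for $0<w<1$: $\delta>\min\{2-2\beta,\,2\}$; - for $w=1$: $\delta>2-2\beta$.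
   Context: Model (for each member of the sequence). Let $n,p,q$ be positive integers with $p\ge 2$ and $n>1+q$. Let $\boldsymbol{X}$ be a deterministic real $n\times q$ matrix with $\mathrm{rank}(\boldsymbol{X})=q$ and $\boldsymbol{X}'\boldsymbol{1}_n=\boldsymbol{0}_q$ (here $'$ is transpose and $\boldsymbol{1}_n$ is the all-ones vector), $\boldsymbol{\mu}\in\mathbb{R}^p$, $\boldsymbol{\alpha}\in\mathbb{R}^q$. Let $\boldsymbol{\Sigma}$ be a $p\times p$ positive-definite matrix with eigenvalues $\lambda_1>\lambda_2\ge\cdots\ge\lambda_p>0$, and let $\boldsymbol{\gamma}_1$ be a unit eigenvector of $\boldsymbol{\Sigma}$ for $\lambda_1$ (all of these except $q$ may vary along the sequence). The observed $n\times p$ matrix is \[ \boldsymbol{Y} = \boldsymbol{1}_n\boldsymbol{\mu}' + \boldsymbol{X}\boldsymbol{\alpha}\boldsymbol{\gamma}_1' + \boldsymbol{E},\qquad \mathrm{vec}(\boldsymbol{E})\sim \mathcal{N}_{np}(\boldsymbol{0}_{np},\boldsymbol{\Sigma}\otimes \boldsymbol{I}_n), \] i.e. the rows of $\boldsymbol{E}$ are i.i.d. $\mathcal{N}_p(\boldsymbol{0}_p,\boldsymbol{\Sigma})$. Estimators. Let \[ \boldsymbol{S}_R = \boldsymbol{Y}'\boldsymbol{X}(\boldsymbol{X}'\boldsymbol{X})^{-1}\boldsymbol{X}'\boldsymbol{Y},\qquad \boldsymbol{S}_E = \boldsymbol{Y}'\Bigl\{ \boldsymbol{I}_n - \tfrac1n\boldsymbol{1}_n\boldsymbol{1}_n'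 - \boldsymbol{X}(\boldsymbol{X}'\boldsymbol{X})^{-1}\boldsymbol{X}' \Bigr\}\boldsymbol{Y}, \] and $\boldsymbol{S}(w) = (1-w)\boldsymbol{S}_R + w\boldsymbol{S}_E$ for $0\le w\le 1$. The estimator $\hat{\boldsymbol{\gamma}}_1(w)$ is the first principal eigenvector of $\boldsymbol{S}(w)$, i.e. a unit eigenvector of $\boldsymbol{S}(w)$ corresponding to its largest eigenvalue. $\|\cdot\|$ is the Euclidean norm. Notation. A quantity $x$ varying along the sequence satisfies $x=\Theta(p^u)$ if $\liminf (x/p^u)>0$ and $\limsup (x/p^u)<\infty$ along the sequence. *)

(* Defs.v *)
From HB Require Import structures.
From mathcomp Require Export all_boot all_order all_algebra.
From mathcomp Require Export mxtens.
From mathcomp Require Export all_classical all_reals all_analysis.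
Export Order.TTheory GRing.Theory Num.Theory.
Export numFieldNormedType.Exports.

Set Implicit Arguments.
Unset Strict Implicit.
Unset Printing Implicit Defensive.

#[global] Open Scope classical_set_scope.
#[global] Open Scope ring_scope.

(* The canonical norm on matrices is the maximum norm, hence this definition. *)
Definition enorm (R : realType) (m : nat) (v : 'cV[R]_m) : R :=
  Num.sqrt (\sum_i v i 0 ^+ 2).

Definition ones (R : realType) (m : nat) : 'cV[R]_m := const_mx 1.

Definition posdefmx (R : realType) (m : nat) (A : 'M[R]_m) : Prop :=
  A^T = A /\ forall v : 'cV[R]_m, v != 0 -> 0 < (v^T *m A *m v) 0 0.

(* s lists the eigenvalues of A in nonincreasing order, with multiplicity. *)
Definition spectrum (R : realType) (m : nat) (A : 'M[R]_m) (s : seq R) : Prop :=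
  sorted >=%R s /\ char_poly A = \prod_(x <- s) ('X - x%:P).

(* eigenvalue is about row vectors (left eigenvectors), but A and its
   transpose have the same eigenvalues. *)
Definition first_eigenvector (R : realType) (m : nat) (A : 'M[R]_m)
    (g : 'cV[R]_m) : Prop :=
  enorm g = 1 /\
  exists2 l : R, A *m g = l *: g & forall l', eigenvalue A l' -> l' <= l.

Definition hatmx (R : realType) (n q : nat) (X : 'M[R]_(n, q)) : 'M[R]_n :=
  X *m invmx (X^T *m X) *m X^T.

Definition SR (R : realType) (n p q : nat) (X : 'M[R]_(n, q))
    (Y : 'M[R]_(n, p)) : 'M[R]_p :=
  Y^T *m hatmx X *m Y.

Definition SE (R : realType) (n p q : nat) (X : 'M[R]_(n, q))
    (Y : 'M[R]_(n, p)) : 'M[R]_p :=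
  Y^T *m (1%:M - n%:R^-1 *: (ones R n *m (ones R n)^T) - hatmx X) *m Y.

Definition Sw (R : realType) (n p q : nat) (w : R) (X : 'M[R]_(n, q))
    (Y : 'M[R]_(n, p)) : 'M[R]_p :=
  (1 - w) *: SR X Y + w *: SE X Y.

(* Column-stacking vec: entry (i, j) of M gets the index of the pair (j, i)
   that tensmx uses, so that the covariance of vec M is of the form
   (column covariance) *t (row covariance). The library's mxvec is row-major. *)
Definition vec (R : realType) (n p : nat) (M : 'M[R]_(n, p)) : 'cV[R]_(p * n) :=
  \col_k M (mxtens_unindex k).2 (mxtens_unindex k).1.

(* Univariate normal law with mean m and variance v >= 0; normal_prob takes the
   standard deviation, and for standard deviation 0 it is not a point mass. *)
Definition normal_law (R : realType) (m v : R) : set R -> \bar R :=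
  if v == 0 then \d_m else normal_prob m (Num.sqrt v).

(* Z ~ N_d(m, V), for V symmetric positive semidefinite: every linear
   combination of the coordinates of Z is univariate normal, with the mean and
   variance given by m and V. *)
Definition gaussian_vector (R : realType) (disp : measure_display)
    (T : measurableType disp) (P : probability T R) (d : nat)
    (Z : T -> 'cV[R]_d) (m : 'cV[R]_d) (V : 'M[R]_d) : Prop :=
  (forall i, measurable_fun [set: T] (fun t => Z t i 0)) /\
  forall (a : 'cV[R]_d) (B : set R), measurable B ->
    P [set t | B ((a^T *m Z t) 0 0)] =
    normal_law ((a^T *m m) 0 0) ((a^T *m V *m a) 0 0) B.

(* x = Theta(y) along the sequence, for y > 0. *)
Definition Theta (R : realType) (x y : nat -> R) : Prop :=
  (0 < limn_einf (fun k => (x k / y k)%:E))%E /\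
  (limn_esup (fun k => (x k / y k)%:E) < +oo)%E.

(* The probability space may change along the sequence. *)
Definition cvg_in_probability (R : realType) (disp : nat -> measure_display)
    (T : forall k, measurableType (disp k)) (P : forall k, probability (T k) R)
    (Z : forall k, T k -> R) (c : R) : Prop :=
  forall eps : R, 0 < eps ->
    (fun k => P k [set t | eps < `|Z k t - c|]) @ \oo --> 0%E.

(* Main.v *)
Require Import Defs.
From mathcomp Require Import measurable_realfun ring lra.

(** Write x = X alpha, s = |x|^2, m = n - 1 - q, and let H be the hat matrix of
    X and M the residual projection I - 11'/n - H.  Since H1 = 0, HX = X,
    M1 = 0 and MX = 0,
      S(w) = a g g' + b Sigma + N,   a = (1-w) s,   b = (1-w) q + w m,
    where g = gamma_1 and, with u = E'x and D_K = E'KE - tr(K) Sigma,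
      N = (1-w) (g u' + u g') + (1-w) D_H + w D_M.
    The signal part has top eigenvector g with gap at least
    G = a + b (lambda_1 - lambda_2).  Comparing the Rayleigh quotients of S(w) at
    g and at its top eigenvector h gives G (1 - <g,h>^2) <= 2 |N|_F, hence
    min_theta |theta h - g|^4 <= 16 |N|_F^2 / G^2.
    The second moment of |N|_F only needs Gaussian moments of order at most 4
    (Isserlis): E|u|^2 = s tr Sigma and E|D_K|_F^2 <= 2 tr(K) (tr Sigma)^2 for a
    projection K.  By Markov's inequality it remains to check that
    ((1-w)^2 (4 s tr Sigma + 2 q (tr Sigma)^2) + 2 w^2 m (tr Sigma)^2) / G^2
    tends to 0: the numerator is O(p^(delta+2)), or O(p^(delta+1)) if w = 0, while
    G is at least of order p^delta if w < 1 and p^(delta+beta) if w > 0. *)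

Set Implicit Arguments.
Unset Strict Implicit.
Unset Printing Implicit Defensive.

(** * Quadratic forms and top eigenvectors *)

(** Matrix determinant lemma: the identity [e] factors one block matrix in two ways, and taking
    determinants of its triangular factors gives the claim. *)
Lemma det1Dmul (R : comPzRingType) n (u : 'cV[R]_n) (v : 'rV[R]_n) :
  \det (1%:M + u *m v) = 1 + (v *m u) 0 0.
Proof.
have e : block_mx (1%:M + u *m v) (- u) 0 1%:M *m block_mx 1%:M 0 v 1%:M
    = block_mx 1%:M 0 v 1%:M *m block_mx 1%:M (- u) 0 (1%:M + v *m u).
  rewrite !mulmx_block !(mul1mx, mulmx1, mul0mx, mulmx0, addr0, add0r).
  by rewrite !(mulNmx, mulmxN) addrK addrC addrK.
have := congr1 determinant e.
rewrite !det_mulmx !det_ublock !det_lblock !det1 !mul1r !mulr1 => ->.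
by rewrite {1}[_ + _]mx11_scalar det_scalar1 mxE mxE eqxx.
Qed.

(** Deflation without diagonalizing: one eigenvalue moves from [l] to [l - c] and the others stay.
    Multiplying out the denominators keeps the identity polynomial. *)
Lemma char_poly_sub_rank1 (F : fieldType) n (A : 'M[F]_n) (g : 'cV[F]_n) (l c : F) :
  (g^T *m g) 0 0 = 1 -> A *m g = l *: g ->
  char_poly (A - c *: (g *m g^T)) * ('X - l%:P) =
  ('X - (l - c)%:P) * char_poly A.
Proof.
move=> g1 Ag.
pose G := map_mx polyC g.
have GG : G^T *m G = 1%:M.
  rewrite map_trmx -map_mxM [g^T *m g]mx11_scalar g1.
  by rewrite map_scalar_mx.
pose B := char_poly_mx A.
have BG : B *m G = ('X - l%:P) *: G.
  rewrite /B /char_poly_mx mulmxBl mul_scalar_mx -map_mxM Ag map_mxZ scalerBl.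
  by [].
have -> : char_poly (A - c *: (g *m g^T)) = \det (B + c%:P *: (G *m G^T)).
  congr (\det _); rewrite /B /char_poly_mx map_mxB map_mxZ map_mxM map_trmx.
  by rewrite opprD opprK addrA.
(* Each linear factor becomes the determinant of a rank-one change of the identity, so both sides
   are determinants of products, which agree because [B *m G] is a multiple of [G]. *)
have D t : \det (1%:M + (t - 1) *: G *m G^T) = t.
  by rewrite det1Dmul -scalemxAr GG !mxE eqxx mulr1n mulr1 addrC subrK.
rewrite -[X in _ * X = _](D ('X - l%:P)) -[X in _ = X * _](D ('X - (l - c)%:P)).
rewrite -det_mulmx mulrC -det_mulmx /char_poly -/B; clearbody B; congr (\det _).
rewrite !mulmxDr !mulmx1 !mulmxDl -!scalemxAl -!scalemxAr -!mulmxA.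
rewrite (mulmxA G^T G) GG mul1mx (mulmxA B) BG -!scalemxAl.
rewrite -addrA; congr (_ + _); rewrite !scalerA -!scalerDl; congr (_ *: _).
by rewrite polyCB; ring.
Qed.

Section quadratic_form.
Context {R : realType}.

Definition qform n (A : 'M[R]_n) (v : 'cV[R]_n) : R := (v^T *m A *m v) 0 0.

Lemma qformE n (A : 'M[R]_n) v : qform A v = \sum_i \sum_j v i 0 * A i j * v j 0.
Proof.
rewrite /qform mxE exchange_big/=; apply: eq_bigr => j _.
by rewrite mxE big_distrl/=; apply: eq_bigr => i _; rewrite !mxE.
Qed.

Lemma enorm2E n (v : 'cV[R]_n) : enorm v ^+ 2 = \sum_i v i 0 ^+ 2.
Proof. by rewrite sqr_sqrtr// sumr_ge0// => i _; exact: sqr_ge0. Qed.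

Lemma sqr_enorm n (v : 'cV[R]_n) : enorm v ^+ 2 = (v^T *m v) 0 0.
Proof.
by rewrite enorm2E mxE; apply: eq_bigr => i _; rewrite mxE expr2.
Qed.

Lemma enorm_ge0 n (v : 'cV[R]_n) : 0 <= enorm v.
Proof. exact: sqrtr_ge0. Qed.

Lemma enorm_eq0 n (v : 'cV[R]_n) : enorm v = 0 -> v = 0.
Proof.
move=> /(congr1 (fun x => x ^+ 2)); rewrite expr0n/= enorm2E => /eqP.
rewrite psumr_eq0 => [/allP h|i _]; last exact: sqr_ge0.
apply/matrixP => i j; rewrite ord1 mxE; apply/eqP; rewrite -sqrf_eq0.
by apply: h; rewrite mem_index_enum.
Qed.

Lemma enormZ n (v : 'cV[R]_n) (c : R) : enorm (c *: v) = `|c| * enorm v.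
Proof.
rewrite /enorm -sqrtr_sqr -sqrtrM ?sqr_ge0// mulr_sumr; congr Num.sqrt.
by apply: eq_bigr => i _; rewrite mxE exprMn.
Qed.

Lemma trmx_mulC n (u v : 'cV[R]_n) : (u^T *m v) 0 0 = (v^T *m u) 0 0.
Proof. by rewrite -[v in LHS]trmxK -trmx_mul mxE. Qed.

Lemma qformZ n (A : 'M[R]_n) v c : qform A (c *: v) = c ^+ 2 * qform A v.
Proof. by rewrite /qform [(c *: v)^T]linearZ/= -!scalemxAl -scalemxAr !mxE mulrA. Qed.

Lemma qform_sub n (A B : 'M[R]_n) v : qform (A - B) v = qform A v - qform B v.
Proof. by rewrite /qform mulmxBr mulmxBl !mxE. Qed.

Lemma qform_add n (A B : 'M[R]_n) v : qform (A + B) v = qform A v + qform B v.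
Proof. by rewrite /qform mulmxDr mulmxDl !mxE. Qed.

Lemma qform_scale n (A : 'M[R]_n) v c : qform (c *: A) v = c * qform A v.
Proof. by rewrite /qform -scalemxAr -scalemxAl mxE. Qed.

Lemma qform_scalar n v c : qform (c%:M : 'M[R]_n) v = c * enorm v ^+ 2.
Proof. by rewrite /qform sqr_enorm mul_mx_scalar -scalemxAl mxE. Qed.

Lemma qform_outer n (a b v : 'cV[R]_n) :
  qform (a *m b^T) v = (a^T *m v) 0 0 * (b^T *m v) 0 0.
Proof.
rewrite /qform mulmxA -mulmxA mxE big_ord1; congr (_ * _).
exact: trmx_mulC.
Qed.

Lemma qformD n (A : 'M[R]_n) (u v : 'cV[R]_n) : A^T = A ->
  qform A (u + v) = qform A u + 2 * (v^T *m (A *m u)) 0 0 + qform A v.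
Proof.
have addE (M N : 'M[R]_1) : (M + N) 0 0 = M 0 0 + N 0 0 by rewrite mxE.
move=> symA; rewrite /qform [(u + v)^T]raddfD/= !(mulmxDl, mulmxDr) !addE.
have -> : (u^T *m A *m v) 0 0 = (v^T *m (A *m u)) 0 0.
  by rewrite -mulmxA trmx_mulC trmx_mul symA mulmxA.
by rewrite -(mulmxA v^T); ring.
Qed.

Lemma continuous_sumr (T : topologicalType) (I : Type) (r : seq I) (F : I -> T -> R) :
  (forall i, continuous (F i)) -> continuous (fun x => \sum_(i <- r) F i x).
Proof.
move=> cF x; elim: r => [|i r ih].
  by under eq_fun do rewrite big_nil; exact: cvg_cst.
rewrite /continuous_at big_cons; under eq_fun do rewrite big_cons.
by apply: cvgD => //; exact: cF.
Qed.

(* This turns a maximizer of a quadratic form on the unit sphere into an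
   eigenvector: subtracting the maximum makes the form negative semidefinite. *)
Lemma seminegdef_null n (W : 'M[R]_n) (c : 'cV[R]_n) : W^T = W ->
  (forall u, qform W u <= 0) -> qform W c = 0 -> W *m c = 0.
Proof.
move=> symW W0 Wc.
set b := W *m c; apply: enorm_eq0.
set N := enorm b ^+ 2; set K := - qform W b.
have K0 : 0 <= K by rewrite oppr_ge0.
have K1 : 0 < K + 1 by lra.
(* At [c + t *: b] the form equals 2tN - Kt^2, which must be nonpositive; take t = N/(K+1), where
   the added 1 keeps the denominator positive. *)
have h : (K + 2) * N ^+ 2 <= 0.
  have := W0 (c + ((K + 1)^-1 * N) *: b).
  rewrite qformD// Wc add0r linearZ/= -scalemxAl mxE -sqr_enorm qformZ.
  rewrite -/N -[qform W b]opprK -/K.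
  move=> /(ler_wpM2r (ltW (exprn_gt0 2 K1))); rewrite mul0r.
  by congr (_ <= _); field; rewrite gt_eqF.
have : N = 0 by apply/eqP; rewrite -sqrf_eq0; apply/eqP; have := sqr_ge0 N; nra.
by move/eqP; rewrite sqrf_eq0 => /eqP.
Qed.

(** The form attains its maximum [l] on the compact unit sphere, which [v0] shows to be nonempty. A
    maximizer annihilates the negative semidefinite form of [A - l%:M], hence is an eigenvector. *)
Lemma rayleigh_sup n (A : 'M[R]_n) (v0 : 'cV[R]_n) : A^T = A -> enorm v0 = 1 ->
  exists2 l, eigenvalue A l & forall v, qform A v <= l * enorm v ^+ 2.
Proof.
move=> symA v01.
pose S := [set u : 'rV[R]_n | \sum_i u 0 i ^+ 2 = 1].
have SE (u : 'rV[R]_n) : \sum_i u 0 i ^+ 2 = enorm u^T ^+ 2.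
  by rewrite enorm2E; apply: eq_bigr => i _; rewrite mxE.
have csq : continuous (fun u : 'rV[R]_n => \sum_i u 0 i ^+ 2).
  apply: continuous_sumr => i u.
  apply: (@continuous_comp _ _ _ (fun u : 'rV[R]_n => u 0 i) (fun x => x ^+ 2)).
    exact: coord_continuous.
  exact: exprn_continuous.
have cS : compact S.
  have cI : compact [set v : 'rV[R]_n | forall i, v ord0 i \in `[(- 1 : R), 1]].
    apply: (@rV_compact _  _ (fun=> `[(- 1 : R), 1]%classic)).
    by move=> _; exact: segment_compact.
  apply: (subclosed_compact _ cI).
    rewrite (_ : S = (fun u : 'rV[R]_n => \sum_i u 0 i ^+ 2) @^-1` [set 1])//.
    by move/continuous_closedP : csq; apply; exact: closed_eq.
  move=> u Su i; rewrite /= in_itv/= -ler_norml -(@ler_pXn2r _ 2) ?nnegrE//.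
  rewrite expr1n -normrX ger0_norm ?sqr_ge0// -Su (bigD1 i)//= lerDl.
  by apply: sumr_ge0 => j _; exact: sqr_ge0.
have cq : continuous (fun u : 'rV[R]_n => qform A u^T).
  under eq_fun do rewrite qformE.
  apply: continuous_sumr => i; apply: continuous_sumr => j u.
  under eq_fun do rewrite !mxE.
  apply: (@continuousM _ _ (fun u : 'rV[R]_n => u 0 i * A i j) (fun u => u 0 j)).
    apply: (@continuousM _ _ (fun u : 'rV[R]_n => u 0 i) (cst (A i j))).
      exact: coord_continuous.
    exact: cst_continuous.
  exact: coord_continuous.
have [] := @EVT_max_rV R n (fun u => qform A u^T) S _ cS _.
- by exists v0^T; rewrite /S/= SE trmxK v01 expr1n.
- exact: continuous_subspaceT.
move=> c /set_mem; rewrite /S/= SE => c1 cmax.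
set l := qform A c^T in cmax *.
(* Homogeneity extends the bound from the sphere to all vectors; the zero vector is treated
   apart. *)
have maxl v : qform A v <= l * enorm v ^+ 2.
  have [v0'|v0'] := eqVneq (enorm v) 0.
    by rewrite v0' (enorm_eq0 v0') /qform mulmx0 mxE expr0n mulr0.
  have := cmax ((enorm v)^-1 *: v^T); rewrite inE/S/= SE linearZ/= trmxK => /(_ _).
  rewrite enormZ exprMn real_normK ?num_real// exprVn mulVf ?sqrf_eq0// => /(_ erefl).
  rewrite qformZ exprVn ler_pdivrMl ?exprn_gt0//; last by rewrite lt_neqAle eq_sym v0' enorm_ge0.
  by rewrite mulrC.
exists l => //; apply/eigenvalueP; exists c; last first.
  apply/negP => /eqP c0; move: c1; rewrite sqr_enorm c0 trmx0 mulmx0 mxE => /eqP.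
  by rewrite eq_sym oner_eq0.
have : (A - l%:M) *m c^T = 0.
  apply: seminegdef_null; rewrite ?qform_sub ?qform_scalar ?c1 ?mulr1 ?subrr//.
    by rewrite linearB/= symA tr_scalar_mx.
  by move=> u; rewrite qform_sub qform_scalar subr_le0.
rewrite mulmxBl mul_scalar_mx => /eqP; rewrite subr_eq0 => /eqP /(congr1 trmx).
by rewrite trmx_mul trmxK symA linearZ/= trmxK.
Qed.

Lemma first_eigenvector_max n (S : 'M[R]_n) (g v : 'cV[R]_n) : S^T = S ->
  first_eigenvector S g -> enorm v = 1 -> qform S v <= qform S g.
Proof.
move=> symS [g1 [l Sg lmax]] v1.
have [m /lmax ml /(_ v)] := rayleigh_sup symS v1.
rewrite v1 expr1n mulr1 => /le_trans; apply; apply: (le_trans ml).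
by rewrite /qform -mulmxA Sg -scalemxAr mxE -sqr_enorm g1 expr1n mulr1.
Qed.

(* [S - (s`_0 - s`_1) g g^T] has the spectrum of [S] with [s`_0] replaced by
   [s`_1]. *)
Lemma qform_le_spectral_gap n (S : 'M[R]_n) (s : seq R) (g v : 'cV[R]_n) :
  S^T = S -> spectrum S s -> enorm g = 1 -> S *m g = s`_0 *: g ->
  qform S v <= s`_1 * enorm v ^+ 2 + (s`_0 - s`_1) * (g^T *m v) 0 0 ^+ 2.
Proof.
move=> symS [ss Ss] g1 Sg.
pose A := S - (s`_0 - s`_1) *: (g *m g^T).
have symA : A^T = A by rewrite /A linearB linearZ/= trmx_mul trmxK symS.
have [l] := rayleigh_sup symA g1.
rewrite eigenvalue_root_char => Al /(_ v).
have l1 : l <= s`_1.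
  have gg : (g^T *m g) 0 0 = 1 by rewrite -sqr_enorm g1 expr1n.
  have := char_poly_sub_rank1 (s`_0 - s`_1) gg Sg.
  (* An empty list would make the characteristic polynomial of [A] equal to 1, which has no root.
     For a one-element list the second entry is the default 0, and deflation moves the only
     eigenvalue exactly there. *)
  rewrite -/A Ss subKr; case: s ss Sg Ss @A symA Al => [|s0 s] ss Sg Ss A symA Al.
    rewrite big_nil mulr1 /= -[RHS]mul1r => /mulIf.
    rewrite polyXsubC_eq0 => /(_ isT) e.
    by move: Al; rewrite e (negbTE (root1 _)).
  rewrite big_cons mulrCA [LHS]mulrC => /mulfI; rewrite polyXsubC_eq0 => /(_ isT) e.
  move: Al; rewrite e rootM root_XsubC => /orP[/eqP ->//|].
  rewrite root_prod_XsubC; case: s ss {Ss A symA e Sg} => //= s1 s /andP[_ ss].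
  rewrite inE => /predU1P[->//|ls].
  by have /allP/(_ _ ls) := order_path_min ge_trans ss.
rewrite /A qform_sub qform_scale qform_outer -expr2 lerBlDr => /le_trans; apply.
by rewrite lerD2r ler_wpM2r// sqr_ge0.
Qed.

(** With c = <g,h>, the better sign gives squared distance 2 - 2|c|, and |c| >= c^2 because |c| <=
    1. *)
Lemma min_enorm_le n (g h : 'cV[R]_n) : enorm g = 1 -> enorm h = 1 ->
  Num.min (enorm (1 *: h - g)) (enorm ((-1) *: h - g)) ^+ 2 <=
  2 * (1 - (g^T *m h) 0 0 ^+ 2).
Proof.
move=> g1 h1; set c : R := (g^T *m h) 0 0.
have E t : t ^+ 2 = 1 -> enorm (t *: h - g) ^+ 2 = 2 - 2 * t * c.
  move=> t1; have qE v : enorm v ^+ 2 = qform (1%:M : 'M[R]_n) v.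
    by rewrite qform_scalar mul1r.
  rewrite qE qformD ?trmx1// qformZ -scaleN1r qformZ -!qE g1 h1 t1 mul1mx.
  have -> : ((-1 *: g)^T *m (t *: h)) 0 0 = - (t * c).
    rewrite [(_ *: g)^T]linearZ/= -scalemxAl -scalemxAr scalerA.
    by rewrite [LHS]mxE -/c mulN1r mulNr.
  by ring.
(* Cauchy-Schwarz for unit vectors, read off from the nonnegativity of 2 - 2c and 2 + 2c. *)
have c1 : c ^+ 2 <= 1.
  have := E 1 (expr1n _ _); have := E (-1); rewrite sqrrN expr1n => /(_ erefl).
  have := sqr_ge0 (enorm (1 *: h - g)); have := sqr_ge0 (enorm (-1 *: h - g)).
  move=> + + e1 e2; rewrite e1 e2; nra.
case: (leP 0 c) => c0.
  apply: (@le_trans _ _ (enorm (1 *: h - g) ^+ 2)).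
    by rewrite ler_pXn2r ?nnegrE ?le_min ?enorm_ge0// ge_min lexx.
  by rewrite E ?expr1n//; nra.
apply: (@le_trans _ _ (enorm ((-1) *: h - g) ^+ 2)).
  by rewrite ler_pXn2r ?nnegrE ?le_min ?enorm_ge0// ge_min lexx orbT.
by rewrite E ?sqrrN ?expr1n//; nra.
Qed.

(** A Davis-Kahan type bound on the squared sine of the angle: optimality of [h] for [S] is played
    against the spectral gap of [Sig], so the perturbation enters only through its form at [g] and
    [h]. *)
Lemma spiked_sin2_le n (S Sig N : 'M[R]_n) (s : seq R) (a b : R) (g h : 'cV[R]_n) :
  Sig^T = Sig -> spectrum Sig s -> enorm g = 1 -> Sig *m g = s`_0 *: g ->
  0 <= b -> S = a *: (g *m g^T) + b *: Sig + N -> S^T = S ->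
  first_eigenvector S h ->
  (a + b * (s`_0 - s`_1)) * (1 - (g^T *m h) 0 0 ^+ 2) <= qform N h - qform N g.
Proof.
move=> symSig specSig g1 Sg b0 SE symS hS.
have [h1 _] := hS.
have := first_eigenvector_max symS hS g1.
have := qform_le_spectral_gap h symSig specSig g1 Sg.
have Sgg : qform Sig g = s`_0.
  by rewrite /qform -mulmxA Sg -scalemxAr mxE -sqr_enorm g1 expr1n mulr1.
rewrite SE !qform_add !qform_scale !qform_outer Sgg -sqr_enorm g1 h1 !expr1n.
move=> h2 h3; have := ler_wpM2l b0 h2; nra.
Qed.

End quadratic_form.

(** * Frobenius norm and eigenvector perturbation *)

Definition frob2 (R : realType) n p (A : 'M[R]_(n, p)) : R :=
  \sum_i \sum_j A i j ^+ 2.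

Section frobenius.
Context {R : realType}.

Lemma frob2_ge0 n p (A : 'M[R]_(n, p)) : 0 <= frob2 A.
Proof. by apply: sumr_ge0 => i _; apply: sumr_ge0 => j _; exact: sqr_ge0. Qed.

Lemma frob2Z n p (A : 'M[R]_(n, p)) c : frob2 (c *: A) = c ^+ 2 * frob2 A.
Proof.
rewrite /frob2 mulr_sumr; apply: eq_bigr => i _; rewrite mulr_sumr.
by apply: eq_bigr => j _; rewrite mxE exprMn.
Qed.

Lemma frob2D3 n p (A B C : 'M[R]_(n, p)) :
  frob2 (A + B + C) <= 3 * (frob2 A + frob2 B + frob2 C).
Proof.
rewrite /frob2 -!big_split/= mulr_sumr; apply: ler_sum => i _.
rewrite -!big_split/= mulr_sumr; apply: ler_sum => j _; rewrite !mxE.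
have := sqr_ge0 (A i j - B i j); have := sqr_ge0 (A i j - C i j).
have := sqr_ge0 (B i j - C i j); nra.
Qed.

Lemma frob2_sym_outer n (g u : 'cV[R]_n) : enorm g = 1 ->
  frob2 (g *m u^T + u *m g^T) <= 4 * enorm u ^+ 2.
Proof.
move=> g1.
apply: (@le_trans _ _ (\sum_i \sum_j
  2 * (g i 0 ^+ 2 * u j 0 ^+ 2 + u i 0 ^+ 2 * g j 0 ^+ 2))).
  apply: ler_sum => i _; apply: ler_sum => j _.
  rewrite !mxE !big_ord1 !mxE.
  by have := sqr_ge0 (g i 0 * u j 0 - u i 0 * g j 0); nra.
have G : \sum_i g i 0 ^+ 2 = 1 by rewrite -enorm2E g1 expr1n.
rewrite le_eqVlt; apply/orP; left; apply/eqP.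
under eq_bigr do rewrite -mulr_sumr big_split/= -!mulr_sumr -enorm2E G mulr1.
rewrite -mulr_sumr big_split/= -mulr_suml G -enorm2E; ring.
Qed.

(** Cauchy-Schwarz for the Frobenius product of [N] with the unit matrix v v': the squared norm of N
    - k v v' expands to [frob2 N - k ^+ 2]. *)
Lemma sqr_qform_le n (N : 'M[R]_n) (v : 'cV[R]_n) : enorm v = 1 ->
  qform N v ^+ 2 <= frob2 N.
Proof.
move=> v1; set k := qform N v.
have V : \sum_i v i 0 ^+ 2 = 1 by rewrite -enorm2E v1 expr1n.
have : 0 <= \sum_i \sum_j (N i j - k * (v i 0 * v j 0)) ^+ 2.
  by apply: sumr_ge0 => i _; apply: sumr_ge0 => j _; exact: sqr_ge0.
rewrite (_ : \sum_i _ = frob2 N - k ^+ 2) ?subr_ge0//.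
transitivity (\sum_i \sum_j (N i j ^+ 2 + (- 2 * k) * (v i 0 * N i j * v j 0)
   + k ^+ 2 * (v i 0 ^+ 2 * v j 0 ^+ 2))).
  by apply: eq_bigr => i _; apply: eq_bigr => j _; ring.
under eq_bigr do rewrite !big_split/= -!mulr_sumr V mulr1.
rewrite !big_split/= -!mulr_sumr V -qformE -/k /frob2; ring.
Qed.

(** The squared distance is at most [2 * z], and [gap * z] is linear in [N]; squaring once more
    brings in [frob2 N], whose mean is computable. One factor 4 comes from (x - y)^2 <= 2x^2 + 2y^2,
    the other from (2z)^2. *)
Lemma spiked_min_enorm_le n (S Sig N : 'M[R]_n) (s : seq R) (a b : R) (g h : 'cV[R]_n) :
  Sig^T = Sig -> spectrum Sig s -> enorm g = 1 -> Sig *m g = s`_0 *: g ->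
  0 <= b -> 0 <= a + b * (s`_0 - s`_1) ->
  S = a *: (g *m g^T) + b *: Sig + N -> S^T = S -> first_eigenvector S h ->
  Num.min (enorm (1 *: h - g)) (enorm ((-1) *: h - g)) ^+ 4 *
    (a + b * (s`_0 - s`_1)) ^+ 2 <= 16 * frob2 N.
Proof.
move=> symSig specSig g1 Sg b0 gap0 SE symS hS.
have h1 : enorm h = 1 by case: hS.
have := min_enorm_le g1 h1.
have := spiked_sin2_le symSig specSig g1 Sg b0 SE symS hS.
have := sqr_qform_le N g1; have := sqr_qform_le N h1.
set gap := a + _; set z := 1 - _; set m := Num.min _ _.
set F := frob2 N; set x := qform N h; set y := qform N g => xF yF gz mz.
have z0 : 0 <= z by have := sqr_ge0 m; lra.
have e1 : (gap * z) ^+ 2 <= 4 * F.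
  apply: (@le_trans _ _ ((x - y) ^+ 2)).
    by rewrite ler_pXn2r ?nnegrE ?(le_trans _ gz) ?mulr_ge0.
  by have := sqr_ge0 (x + y); nra.
have e2 : m ^+ 4 <= 4 * z ^+ 2.
  rewrite (_ : m ^+ 4 = (m ^+ 2) ^+ 2); last by rewrite -exprM.
  rewrite (_ : 4 * z ^+ 2 = (2 * z) ^+ 2); last by ring.
  by rewrite ler_pXn2r ?nnegrE ?sqr_ge0 ?mulr_ge0.
apply: (@le_trans _ _ (4 * z ^+ 2 * gap ^+ 2)); first by rewrite ler_wpM2r ?sqr_ge0.
by rewrite exprMn in e1; nra.
Qed.

End frobenius.

(** Sum over i and j the inequality S_ij^2 <= S_ii S_jj, the nonnegativity of the 2 by 2 principal
    minors. *)
Lemma frob2_posdef_le (R : realType) n (S : 'M[R]_n) : posdefmx S ->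
  frob2 S <= \tr S ^+ 2.
Proof.
move=> [symS posS].
have symE k l : S k l = S l k by rewrite -[in LHS]symS mxE.
have entry i j : ((delta_mx i 0 : 'cV[R]_n)^T *m (S *m (delta_mx j 0 : 'cV[R]_n))) 0 0 = S i j.
  by rewrite mulmxA trmx_delta -rowE -colE !mxE.
have diag i : qform S (delta_mx i 0) = S i i by rewrite /qform -mulmxA entry.
have diag_gt0 i : 0 < S i i.
  rewrite -diag; apply: posS; apply/eqP => /matrixP/(_ i 0)/eqP.
  by rewrite !mxE !eqxx oner_eq0.
rewrite /frob2 expr2 {1}/mxtrace mulr_suml; apply: ler_sum => i _.
rewrite /mxtrace mulr_sumr; apply: ler_sum => j _.
(* The form at [v] is S_jj (S_ii S_jj - S_ij^2), and S_jj > 0 can be cancelled. *)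
pose v := S j j *: (delta_mx i 0 : 'cV[R]_n) + (- S i j) *: delta_mx j 0.
have : 0 <= qform S v.
  have [->|/posS/ltW//] := eqVneq v 0.
  by rewrite /qform mulmx0 mxE.
rewrite qformD// !qformZ !diag [(_ *: _)^T]linearZ/= -scalemxAl.
rewrite -scalemxAr -scalemxAr scalerA mxE entry (symE j i).
have := diag_gt0 j; nra.
Qed.

(** * Moments of the normal law *)

Section gauss_moments.
Context {R : realType}.
Local Notation mu := (@lebesgue_measure R).
Implicit Types (r x c : R) (k : nat).

(** The scale [r] is a parameter to differentiate in: each derivative brings down a factor -2 r x^2
    and so raises [k] by one. *)
Definition gauss_mono k r x : R := x ^+ (2 * k) * expR (- (r * x) ^+ 2).

Lemma gauss_mono_ge0 k r x : 0 <= gauss_mono k r x.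
Proof. by rewrite mulr_ge0 ?expR_ge0// exprM exprn_ge0// sqr_ge0. Qed.

Lemma measurable_gauss_mono k r : measurable_fun [set: R] (gauss_mono k r).
Proof.
apply: measurable_funM; first exact: measurable_funX.
apply: measurableT_comp => //; apply: measurableT_comp => //.
by apply: measurable_funX; exact: measurable_funM.
Qed.

Lemma integral_gauss_mono0 r : 0 < r ->
  (\int[mu]_x (gauss_mono 0 r x)%:E = (Num.sqrt pi / r)%:E)%E.
Proof.
move=> r0.
(* The standard deviation for which the normal density has exponent -(r x)^2; its total mass 1 then
   gives the integral. *)
pose s := (r * Num.sqrt 2)^-1.
have s0 : s != 0 by rewrite invr_neq0// mulf_neq0 ?gt_eqF// sqrtr_gt0.
have s2 : s ^+ 2 *+ 2 = r ^- 2.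
  rewrite /s exprVn exprMn sqr_sqrtr// -mulr_natr invfM -mulr_natr -mulrA mulVf ?mulr1//.
  have pk : normal_peak s = r / Num.sqrt pi.
  rewrite /normal_peak -mulrnAl s2 sqrtrM ?invr_ge0 ?sqr_ge0//.
  by rewrite -exprVn sqrtr_sqr gtr0_norm ?invr_gt0// invfM invrK.
have npi : Num.sqrt pi != 0 :> R by rewrite gt_eqF// sqrtr_gt0 pi_gt0.
have pdf x : gauss_mono 0 r x = Num.sqrt pi / r * normal_pdf 0 s x.
  rewrite normal_pdfE// pk /gauss_mono /normal_fun subr0 s2 muln0 expr0 mul1r.
  have -> : - x ^+ 2 / r ^- 2 = - (r * x) ^+ 2 by rewrite invrK; ring.
  by field; rewrite npi gt_eqF.
under eq_integral do rewrite pdf EFinM.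
rewrite integralZl//; last exact: integrable_normal_pdf.
by rewrite integral_normal_pdf mule1.
Qed.

Lemma exprn_le_expR k x : 0 <= x -> x ^+ k <= k`!%:R * expR x.
Proof.
case: k => [|k] x0.
  by rewrite expr0 fact0 mul1r -[leLHS]expR0 ler_expR.
rewrite -ler_pdivrMl ?ltr0n ?fact_gt0// mulrC.
by apply: le_trans (expR_ge1Dxn k x0); rewrite lerDr.
Qed.

(** Half of the exponent absorbs the power of x, by t^k <= k! e^t at t = r^2 x^2 / 2; the other half
    is a Gaussian of scale r / sqrt 2. *)
Lemma gauss_mono_le k r x : 0 < r -> gauss_mono k r x <=
  k`!%:R / (r ^+ 2 / 2) ^+ k * gauss_mono 0 (r / Num.sqrt 2) x.
Proof.
move=> r0; have a0 : 0 < r ^+ 2 / 2 by rewrite divr_gt0// exprn_gt0.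
have s2 : (r / Num.sqrt 2 * x) ^+ 2 = r ^+ 2 / 2 * x ^+ 2.
  by rewrite !exprMn exprVn sqr_sqrtr.
rewrite /gauss_mono muln0 expr0 mul1r s2 mulrAC ler_pdivlMr ?exprn_gt0//.
have /(exprn_le_expR k) : 0 <= r ^+ 2 / 2 * x ^+ 2.
  by rewrite mulr_ge0 ?sqr_ge0// ltW.
rewrite exprMn -exprM => h.
rewrite mulrAC; apply: le_trans (ler_wpM2r (expR_ge0 _) (_ : _ <= _)) _.
  by rewrite mulrC; exact: h.
rewrite -(mulrA k`!%:R) -expRD le_eqVlt; apply/orP; left; apply/eqP.
congr (_ * expR _); by field.
Qed.

Lemma integrable_gauss_mono k r : 0 < r ->
  mu.-integrable setT (EFin \o gauss_mono k r).
Proof.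
move=> r0; set r' := r / Num.sqrt 2.
have r'0 : 0 < r' by rewrite divr_gt0// sqrtr_gt0.
set C := k`!%:R / (r ^+ 2 / 2) ^+ k.
apply: (@le_integrable _ _ _ mu _ measurableT _
  (fun x => C%:E * (gauss_mono 0 r' x)%:E)%E).
- by apply/measurable_EFinP; exact: measurable_gauss_mono.
- move=> x _; rewrite /= lee_fin ger0_norm ?gauss_mono_ge0//.
  by apply: le_trans (ler_norm _); exact: gauss_mono_le.
- apply: integrableZl => //; apply/integrableP; split.
    by apply/measurable_EFinP; exact: measurable_gauss_mono.
  under eq_integral do rewrite /= ger0_norm ?gauss_mono_ge0//.
  by rewrite integral_gauss_mono0// ltry.
Qed.

Lemma is_derive_gauss_mono k r x :
  is_derive r 1 (fun r => gauss_mono k r x) (- 2 * r * gauss_mono k.+1 r x).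
Proof.
rewrite /gauss_mono; apply: is_derive_eq.
rewrite /GRing.scale/= mulnS exprD; ring.
Qed.

(** Differentiate the formula for [k] in [r] under the integral sign and solve for the next
    integral. *)
Lemma Rintegral_gauss_monoS k c :
  (forall r, 0 < r -> \int[mu]_x gauss_mono k r x = c / r ^+ (2 * k).+1) ->
  forall r, 0 < r ->
  \int[mu]_x gauss_mono k.+1 r x = c * (2 * k).+1%:R / 2 / r ^+ (2 * k.+1).+1.
Proof.
move=> ih r r0.
(* Dominates the derivative for all parameters y in (r/2, 2r): there 2y <= 4r, and the Gaussian
   factor is largest at the smallest scale. *)
pose G x := 4 * r * gauss_mono k.+1 (r / 2) x.
have rI : `](r / 2), (2 * r)[%classic r.
  by rewrite /= in_itv/=; apply/andP; split; lra.
have d1 y x : partial1of2 (fun r x => gauss_mono k r x) y x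
    = - 2 * y * gauss_mono k.+1 y x.
  rewrite /partial1of2 derive1E.
  exact: (@derive_val _ _ _ _ _ _ _ (is_derive_gauss_mono k y x)).
have := @differentiation_under_integral R _ _ mu (gauss_mono k) setT measurableT
  r (r / 2) (2 * r) rI _ _ G _ _ _.
have L : is_derive r 1 (fun x => \int[mu]_y gauss_mono k x y)
       (- c * (2 * k).+1%:R / r ^+ (2 * k).+2).
  apply: (@near_eq_is_derive _ _ _ (fun x : R => c * (x ^+ (2 * k).+1)^-1)).
    (* The closed form holds for positive parameters only, which suffices near [r]. *)
    by near=> y; rewrite ih//; near: y; exact: (@lt_nbhsr R 0 r r0).
  have rn0 : r ^+ (2 * k).+1 != 0 by rewrite expf_neq0// gt_eqF.
  have dX : derivable (fun x : R => x ^+ (2 * k).+1) r 1 by exact: exprn_derivable.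
  apply: DeriveDef; first by apply: derivableM => //; exact: derivableV.
  rewrite deriveM//; last exact: derivableV.
  rewrite deriveV// derive_cst scaler0 addr0 exp_derive /GRing.scale/=.
  rewrite !exprS; field.
  by rewrite expf_neq0 gt_eqF.
rewrite derive1E (@derive_val _ _ _ _ _ _ _ L) => h.
have h' : - c * (2 * k).+1%:R / r ^+ (2 * k).+2 = - 2 * r * \int[mu]_x gauss_mono k.+1 r x.
  rewrite h//.
  - rewrite -RintegralZl//.
      by apply: eq_Rintegral => x _; exact: d1.
    exact: integrable_gauss_mono.
  - by move=> x /=; rewrite in_itv/= => /andP[x0 _]; apply: integrable_gauss_mono; lra.
  - by move=> y; apply: mulr_ge0; rewrite ?gauss_mono_ge0//; lra.
  - have : mu.-integrable setT (fun x => (4 * r)%:E * (gauss_mono k.+1 (r / 2) x)%:E)%E.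
      by apply: integrableZl => //; apply: integrable_gauss_mono; lra.
    by apply: eq_integrable.
  - move=> x y /=; rewrite in_itv/= => /andP[x1 x2] _; rewrite d1.
    rewrite normrM [X in _ * X]ger0_norm ?gauss_mono_ge0//.
    apply: ler_pM; rewrite ?gauss_mono_ge0//.
      by rewrite ler_norml; apply/andP; split; lra.
    apply: ler_wpM2l; first by rewrite exprM exprn_ge0// sqr_ge0.
    rewrite ler_expR lerN2.
    rewrite 2![(_ * y) ^+ 2]exprMn; apply: ler_wpM2r; first exact: sqr_ge0.
    by rewrite ler_pXn2r ?nnegrE//; lra.
have -> : \int[mu]_x gauss_mono k.+1 r x = (- c * (2 * k).+1%:R / r ^+ (2 * k).+2) / (- 2 * r).
  by rewrite h'; field; rewrite gt_eqF.
rewrite (_ : (2 * k.+1).+1 = (2 * k).+3)%N; last by rewrite mulnS.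
rewrite ![r ^+ _.+2]exprS [r ^+ _.+1]exprS.
field; rewrite ?expf_neq0 ?gt_eqF//.
Unshelve. all: end_near. Qed.

Lemma Rintegral_gauss_mono k r : 0 < r ->
  \int[mu]_x gauss_mono k r x =
  Num.sqrt pi * (\prod_(i < k) (2 * i).+1%:R) / 2 ^+ k / r ^+ (2 * k).+1.
Proof.
elim: k r => [|k ih] r r0.
  by rewrite big_ord0 mulr1 expr0 divr1 /Rintegral integral_gauss_mono0.
rewrite (Rintegral_gauss_monoS ih)// big_ord_recr/= [2 ^+ k.+1]exprS; field.
by rewrite ?expf_neq0// gt_eqF.
Qed.

Lemma normal_pdf_gauss s x : 0 < s ->
  normal_pdf 0 s x =
  (s * Num.sqrt 2 * Num.sqrt pi)^-1 * gauss_mono 0 (s * Num.sqrt 2)^-1 x.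
Proof.
move=> s0; rewrite normal_pdfE ?gt_eqF// /gauss_mono muln0 expr0 mul1r.
congr (_^-1 * expR _).
  rewrite -mulr_natr -mulrA [pi * _]mulrC mulrA sqrtrM ?mulr_ge0 ?sqr_ge0 ?ltW//.
  by rewrite sqrtrM ?sqr_ge0// sqrtr_sqr gtr0_norm.
rewrite subr0 mulNr exprMn exprVn exprMn sqr_sqrtr// mulr_natr.
by rewrite [_^-1 * _]mulrC.
Qed.

End gauss_moments.

(** * Densities and the even moments of the normal law *)

Section density.
Context d (T : measurableType d) (R : realType).
Variables (nu : {finite_measure set T -> \bar R})
  (mu : {sigma_finite_measure set T -> \bar R}) (g : T -> \bar R).
Hypotheses (mg : measurable_fun setT g).
Hypothesis nug : forall A, measurable A -> nu A = (\int[mu]_(x in A) g x)%E.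
Hypothesis numu : nu `<< mu.

(** The Radon-Nikodym derivative is determined up to null sets; it agrees almost everywhere with the
    explicit density [g] because both integrate to [nu]. *)
Lemma ge0_integral_density (f : T -> \bar R) : (forall x, 0 <= f x)%E ->
  measurable_fun setT f -> (\int[nu]_x f x = \int[mu]_x (f x * g x))%E.
Proof.
move=> f0 mf.
rewrite -(Radon_Nikodym_SigmaFinite.change_of_variables numu)//.
have hi := Radon_Nikodym_SigmaFinite.f_integrable numu.
have mh := measurable_int _ hi.
apply: ae_eq_integral => //; try exact: emeasurable_funM.
have : ae_eq mu setT (Radon_Nikodym_SigmaFinite.f nu mu) g.
  apply: integral_ae_eq => // E _ mE.
  by rewrite -nug// -Radon_Nikodym_SigmaFinite.f_integral.
by apply: filterS => x /= h _; rewrite h.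
Qed.

End density.

Section normal_moments.
Context {R : realType}.
Local Notation mu := (@lebesgue_measure R).

(** The product is the double factorial (2k-1)!!. The moment is the [gauss_mono] integral at scale
    1/(s sqrt 2), up to normalization. *)
Lemma normal_prob_moment k (s : R) : 0 < s ->
  (\int[normal_prob 0 s]_x (x ^+ (2 * k))%:E = ((\prod_(i < k) (2 * i).+1%:R) * s ^+ (2 * k))%:E)%E.
Proof.
move=> s0.
have pi0 : Num.sqrt pi != 0 :> R by rewrite gt_eqF// sqrtr_gt0 pi_gt0.
have r0 : 0 < (s * Num.sqrt 2)^-1 by rewrite invr_gt0 mulr_gt0// sqrtr_gt0.
rewrite (@ge0_integral_density _ _ _ _ mu (fun x => (normal_pdf 0 s x)%:E))//.
- under eq_integral => x _ do rewrite normal_pdf_gauss// -EFinM mulrCA.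
  rewrite (@eq_integral _ _ _ mu _ (fun x => ((s * Num.sqrt 2 * Num.sqrt pi)^-1)%:E *
      (gauss_mono k (s * Num.sqrt 2)^-1 x)%:E)%E); last first.
    by move=> x _; rewrite -EFinM /gauss_mono muln0 expr0 mul1r.
  rewrite integralZl//; last exact: integrable_gauss_mono.
  have := Rintegral_gauss_mono k r0; rewrite /Rintegral => h.
  rewrite -[(\int[_]_x _)%E]fineK; last first.
    exact: (integrable_fin_num measurableT (integrable_gauss_mono k r0)).
  rewrite h -EFinM; congr EFin.
  have s2 : Num.sqrt 2 ^+ (2 * k) = 2 ^+ k :> R by rewrite exprM sqr_sqrtr.
  rewrite exprVn invrK exprMn exprS [Num.sqrt 2 ^+ _]exprS s2; field.
  by rewrite pi0 !expf_neq0 ?pnatr_eq0 ?gt_eqF// sqrtr_gt0.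
- by apply/measurable_EFinP; exact: measurable_normal_pdf.
- exact: normal_prob_dominates.
- by move=> x; rewrite lee_fin exprM exprn_ge0// sqr_ge0.
- by apply/measurable_EFinP; exact: measurable_funX.
Qed.

Lemma normal_law_moment k d (T : measurableType d) (P : probability T R)
    (X : T -> R) (v : R) :
  measurable_fun setT X -> (0 < k)%N -> 0 <= v ->
  (forall B, measurable B -> P [set t | B (X t)] = normal_law 0 v B) ->
  (\int[P]_t (X t ^+ (2 * k))%:E =
   ((\prod_(i < k) (2 * i).+1%:R) * v ^+ k)%:E)%E.
Proof.
move=> mX k0 v0 PX.
have mk : measurable_fun setT (fun x : R => (x ^+ (2 * k))%:E).
  by apply/measurable_EFinP; exact: measurable_funX.
have k_ge0 x : (0 <= (x ^+ (2 * k))%:E :> \bar R)%E.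
  by rewrite lee_fin exprM exprn_ge0// sqr_ge0.
transitivity (\int[pushforward P (X : T -> measurableTypeR R)]_x (x ^+ (2 * k))%:E)%E.
  by rewrite ge0_integral_pushforward// preimage_setT.
(* At variance 0 the law is a point mass at 0, and both sides vanish since [0 < k]. *)
have := PX; rewrite /normal_law; case: eqVneq => [->|vn0] {}PX.
  rewrite (eq_measure_integral (\d_(0 : measurableTypeR R)))//; last first.
    by move=> A mA _; exact: (PX A mA).
  rewrite integral_dirac// diracT mul1e.
  by rewrite !expr0n muln_eq0/= (gtn_eqF k0) mulr0.
transitivity (\int[normal_prob 0 (Num.sqrt v)]_x (x ^+ (2 * k))%:E)%E.
  by apply: eq_measure_integral => A mA _; exact: (PX A mA).
rewrite normal_prob_moment ?sqrtr_gt0 ?lt_neqAle ?v0 1?eq_sym ?vn0//.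
by rewrite exprM sqr_sqrtr.
Qed.

End normal_moments.

(** * Moments of Gaussian matrices *)

Lemma measurable_gt_fun d (T : measurableType d) (R : realType) (f : T -> R)
    (c : R) :
  measurable_fun setT f -> measurable [set t | c < f t].
Proof.
move=> mf; rewrite -[X in measurable X]setTI.
rewrite -[[set _ | _]]/(f @^-1` [set x | c < x]).
apply: mf => //; rewrite (_ : [set x | c < x] = `]c, +oo[%classic)//.
by apply/seteqP; split => x /=; rewrite in_itv/= andbT.
Qed.

Section has_mean.
Context d (T : measurableType d) (R : realType) (P : probability T R).
Implicit Types (f g : T -> R) (v c : R).

(** Integrability is bundled with the value, so that means of polynomials in Gaussian entries can be
    assembled by linearity alone. *)
Definition has_mean f v :=
  P.-integrable setT (EFin \o f) /\ (\int[P]_t (f t)%:E = v%:E)%E.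

Lemma has_mean_measurable f v : has_mean f v -> measurable_fun setT f.
Proof. by move=> [/measurable_int/measurable_EFinP]. Qed.

Lemma eq_has_mean f g v : f =1 g -> has_mean f v -> has_mean g v.
Proof. by move=> /funext ->. Qed.

Lemma has_meanD f g v c : has_mean f v -> has_mean g c ->
  has_mean (fun t => f t + g t) (v + c).
Proof.
move=> [fi fv] [gi gc]; split.
  by have := integrableD measurableT fi gi; apply: eq_integrable.
by under eq_integral do rewrite EFinD; rewrite integralD// fv gc.
Qed.

Lemma has_meanZ c f v : has_mean f v -> has_mean (fun t => c * f t) (c * v).
Proof.
move=> [fi fv]; split.
  by have := integrableZl measurableT c fi; apply: eq_integrable.
by under eq_integral do rewrite EFinM; rewrite integralZl// fv.
Qed.

Lemma has_mean_cst c : has_mean (fun=> c) c.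
Proof.
split; first exact: finite_measure_integrable_cst.
rewrite -[RHS]mule1 -(probability_setT P).
exact: (integral_cst P measurableT c%:E).
Qed.

Lemma has_mean_sum (I : Type) (r : seq I) (f : I -> T -> R) (v : I -> R) :
  (forall i, has_mean (f i) (v i)) ->
  has_mean (fun t => \sum_(i <- r) f i t) (\sum_(i <- r) v i).
Proof.
move=> h; elim: r => [|i r ih].
  by rewrite big_nil; under eq_fun do rewrite big_nil; exact: has_mean_cst.
by rewrite big_cons; under eq_fun do rewrite big_cons; exact: has_meanD.
Qed.

Lemma has_mean_ge0 f v : (forall t, 0 <= f t) -> measurable_fun setT f ->
  (\int[P]_t (f t)%:E = v%:E)%E -> has_mean f v.
Proof.
move=> f0 mf fv; split => //; apply/integrableP; split.
  exact/measurable_EFinP.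
by under eq_integral do rewrite /= ger0_norm//; rewrite fv ltry.
Qed.

Lemma has_mean_markov f v (e : R) : (forall t, 0 <= f t) -> has_mean f v ->
  0 < e -> (P [set t | (e < f t)%R] <= (v / e)%:E)%E.
Proof.
move=> f0 fv e0; have mf := has_mean_measurable fv.
have mA : measurable [set t | e < f t] by exact: measurable_gt_fun.
rewrite EFinM lee_pdivlMr// muleC -(integral_cst P mA e%:E) -fv.2.
apply: (@le_trans _ _ (\int[P]_(t in [set t | (e < f t)%R]) (f t)%:E)%E).
  apply: ge0_le_integral => //.
  - by move=> t _; rewrite lee_fin ltW.
  - exact/measurable_EFinP/measurable_funTS.
  - by move=> t /= /ltW; rewrite lee_fin.
apply: ge0_subset_integral => //; first exact/measurable_EFinP.
by move=> t _; rewrite lee_fin.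
Qed.

End has_mean.

Section gaussian_moments.
Context dT (T : measurableType dT) (R : realType) (P : probability T R).
Variables (d : nat) (Z : T -> 'cV[R]_d) (V : 'M[R]_d).
Hypotheses (gZ : gaussian_vector P Z 0 V) (symV : V^T = V).
Hypothesis psdV : forall a, 0 <= qform V a.

Let L (a : 'cV[R]_d) t : R := (a^T *m Z t) 0 0.
Let C (a b : 'cV[R]_d) : R := (a^T *m V *m b) 0 0.

Let mL a : measurable_fun setT (L a).
Proof.
rewrite /L; under eq_fun do rewrite mxE.
apply: (@measurable_sum _ _ _ _ _ _ (fun j t => a^T 0 j * Z t j 0)) => i.
by apply: measurable_funM => //; case: gZ.
Qed.

Let L_moment k a : (0 < k)%N ->
  has_mean P (fun t => L a t ^+ (2 * k)) ((\prod_(i < k) (2 * i).+1%:R) * C a a ^+ k).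
Proof.
move=> k0; apply: has_mean_ge0.
- by move=> t; rewrite exprM exprn_ge0// sqr_ge0.
- exact: measurable_funX.
- apply: normal_law_moment => //; first exact: psdV.
  by move=> B mB; case: gZ => _ /(_ a B mB); rewrite mulmx0 mxE.
Qed.

Let CDl a b c : C (a + b) c = C a c + C b c.
Proof. by rewrite /C [(_ + _)^T]raddfD/= !mulmxDl mxE. Qed.
Let CDr a b c : C c (a + b) = C c a + C c b.
Proof. by rewrite /C mulmxDr mxE. Qed.
Let CNl a b : C (- a) b = - C a b.
Proof. by rewrite /C [(- _)^T]raddfN/= !mulNmx mxE. Qed.
Let CNr a b : C a (- b) = - C a b.
Proof. by rewrite /C mulmxN mxE. Qed.
Let CC a b : C a b = C b a.
Proof. by rewrite /C -mulmxA trmx_mulC trmx_mul symV. Qed.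
Let LD a b t : L (a + b) t = L a t + L b t.
Proof. by rewrite /L [(_ + _)^T]raddfD/= !mulmxDl mxE. Qed.
Let LN a t : L (- a) t = - L a t.
Proof. by rewrite /L [(- _)^T]raddfN/= !mulNmx mxE. Qed.

(** Polarization of the variance: 4xy = (x+y)^2 - (x-y)^2. *)
Lemma gaussian_moment2 a b : has_mean P (fun t => L a t * L b t) (C a b).
Proof.
have h c : has_mean P (fun t => L c t ^+ 2) (C c c).
  by have := L_moment c (ltn0Sn 0); rewrite big_ord1 mul1r expr1.
have -> : C a b = 4^-1 * C (a + b) (a + b) + - 4^-1 * C (a - b) (a - b).
  by rewrite !(CDl, CDr, CNl, CNr) (CC b a); field.
apply: eq_has_mean (has_meanD (has_meanZ _ (h (a + b))) (has_meanZ _ (h (a - b)))).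
by move=> t; rewrite /= !(LD, LN); field.
Qed.

(* Isserlis' formula, by polarization of E[X^4] = 3 Var(X)^2. *)
Lemma gaussian_moment4 a b c e : has_mean P (fun t => L a t * L b t * (L c t * L e t))
  (C a b * C c e + C a c * C b e + C a e * C b c).
Proof.
have h f : has_mean P (fun t => L f t ^+ 4) (3 * C f f ^+ 2).
  by have := L_moment f (ltn0Sn 1); rewrite !big_ord_recl big_ord0 mulr1 mul1r.
(* Summing (a ± b ± c ± e)^4 over the 8 sign choices, weighted by the product of the signs, leaves 8
   * 4! = 192 times abce. [hp] serves the positive weights, [hm] the negative ones. *)
have hp := has_meanZ 192^-1 (h _).
have hm := has_meanZ (- 192^-1) (h _).
have H := has_meanD (has_meanD (has_meanD (hp (a + b + c + e)) (hp (a + b - c - e)))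
    (has_meanD (hp (a - b + c - e)) (hp (a - b - c + e))))
  (has_meanD (has_meanD (hm (a - b + c + e)) (hm (a + b - c + e)))
    (has_meanD (hm (a + b + c - e)) (hm (a - b - c - e)))).
have -> : C a b * C c e + C a c * C b e + C a e * C b c =
  192^-1 * (3 * C (a + b + c + e) (a + b + c + e) ^+ 2) +
     192^-1 * (3 * C (a + b - c - e) (a + b - c - e) ^+ 2) +
     (192^-1 * (3 * C (a - b + c - e) (a - b + c - e) ^+ 2) +
      192^-1 * (3 * C (a - b - c + e) (a - b - c + e) ^+ 2)) +
     (- 192^-1 * (3 * C (a - b + c + e) (a - b + c + e) ^+ 2) +
      - 192^-1 * (3 * C (a + b - c + e) (a + b - c + e) ^+ 2) +
      (- 192^-1 * (3 * C (a + b + c - e) (a + b + c - e) ^+ 2) +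
       - 192^-1 * (3 * C (a - b - c - e) (a - b - c - e) ^+ 2))).
  rewrite !(CDl, CDr, CNl, CNr) (CC b a) (CC c a) (CC c b) (CC e a) (CC e b) (CC e c).
  by field.
by apply: eq_has_mean H => t; rewrite /= !(LD, LN); field.
Qed.

End gaussian_moments.

Lemma sum_mxtens (V : nmodType) (p n : nat) (F : 'I_(p * n) -> V) :
  \sum_k F k = \sum_j \sum_i F (mxtens_index (j, i)).
Proof.
rewrite pair_big/= (reindex (@mxtens_index p n)) /=; last first.
  by exists (@mxtens_unindex p n) => i _; rewrite (mxtens_indexK, mxtens_unindexK).
by apply: eq_bigr => -[].
Qed.

Lemma sum_delta (R : pzSemiRingType) n (i : 'I_n) (F : 'I_n -> R) :
  \sum_j F j * (i == j)%:R = F i.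
Proof.
rewrite (bigD1 i)//= eqxx mulr1 big1 ?addr0// => j ji.
by rewrite eq_sym (negbTE ji) mulr0.
Qed.

Section gaussian_matrix.
Context dT (T : measurableType dT) (R : realType) (P : probability T R).
Variables (n p : nat) (E : T -> 'M[R]_(n, p)) (Sig : 'M[R]_p).
Hypotheses (gE : gaussian_vector P (fun t => vec (E t)) 0 (Sig *t 1%:M)).
Hypotheses (symSig : Sig^T = Sig) (psdSig : forall a, 0 <= qform Sig a).

Let symV : (Sig *t (1%:M : 'M[R]_n))^T = Sig *t 1%:M.
Proof. by rewrite trmx_tens trmx1 symSig. Qed.

Let psdV a : 0 <= qform (Sig *t (1%:M : 'M[R]_n)) a.
Proof.
(* Regrouped by rows of the matrix, the covariance is block diagonal with blocks [Sig], so the form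
   splits into one form of [Sig] per row. *)
pose col_ i : 'cV[R]_p := \col_j a (mxtens_index (j, i)) 0.
rewrite (_ : qform _ a = \sum_i qform Sig (col_ i)); first exact: sumr_ge0.
rewrite qformE sum_mxtens exchange_big; apply: eq_bigr => i _.
rewrite qformE; apply: eq_bigr => j _; rewrite sum_mxtens.
apply: eq_bigr => k _; rewrite (bigD1 i)//= big1 ?addr0 => [|l li].
  by rewrite tensmxE mxE eqxx mulr1 !mxE.
by rewrite tensmxE mxE eq_sym (negbTE li) mulr0 mulr0 mul0r.
Qed.

Let e i j : 'cV[R]_(p * n) := delta_mx (mxtens_index (j, i)) 0.

Let eE i j t : ((e i j)^T *m vec (E t)) 0 0 = E t i j.
Proof. by rewrite /e trmx_delta -rowE !mxE mxtens_indexK. Qed.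

Let eVe i j k l : ((e i j)^T *m (Sig *t 1%:M) *m e k l) 0 0 = (i == k)%:R * Sig j l.
Proof. by rewrite /e trmx_delta -rowE -colE !mxE !mxtens_indexK mulrC. Qed.

Lemma gaussian_matrix_moment2 i j k l :
  has_mean P (fun t => E t i j * E t k l) ((i == k)%:R * Sig j l).
Proof.
have := gaussian_moment2 gE symV psdV (e i j) (e k l); rewrite eVe.
by apply: eq_has_mean => t; rewrite !eE.
Qed.

Lemma gaussian_matrix_moment4 i j k l i' j' k' l' :
  has_mean P (fun t => E t i j * E t k l * (E t i' j' * E t k' l'))
   ((i == k)%:R * Sig j l * ((i' == k')%:R * Sig j' l')
   + (i == i')%:R * Sig j j' * ((k == k')%:R * Sig l l')
   + (i == k')%:R * Sig j l' * ((k == i')%:R * Sig l j')).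
Proof.
have := gaussian_moment4 gE symV psdV (e i j) (e k l) (e i' j') (e k' l').
by rewrite !eVe; apply: eq_has_mean => t; rewrite !eE.
Qed.

(** For [K = x *m x^T] the trace is |E'x|^2, the squared norm of the cross-term vector. *)
Lemma has_mean_trmx_mul (K : 'M[R]_n) :
  has_mean P (fun t => \tr ((E t)^T *m K *m E t)) (\tr K * \tr Sig).
Proof.
have h j a b := has_meanZ (K a b) (gaussian_matrix_moment2 a j b j).
have := has_mean_sum (index_enum _) (fun j => has_mean_sum (index_enum _) (fun a =>
  has_mean_sum (index_enum _) (fun b => h j a b))).
rewrite (_ : \sum_j _ = \tr K * \tr Sig).
  apply: eq_has_mean => t; apply: eq_bigr => j _.
  rewrite mxE exchange_big; apply: eq_bigr => b _.
  rewrite mxE big_distrl/=; apply: eq_bigr => a _; rewrite mxE; ring.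
rewrite /mxtrace mulr_sumr; apply: eq_bigr => j _.
rewrite mulr_suml; apply: eq_bigr => a _.
rewrite (bigD1 a)//= eqxx mul1r big1 ?addr0// => b ba.
by rewrite eq_sym (negbTE ba) mul0r mulr0.
Qed.

(** The subtracted multiple of [Sig] is the entrywise mean, by [has_mean_scatter]. *)
Definition scatter_dev (K : 'M[R]_n) t : 'M[R]_p :=
  (E t)^T *m K *m E t - \tr K *: Sig.

Let scatterE K t i j :
  ((E t)^T *m K *m E t) i j = \sum_a \sum_b K a b * (E t a i * E t b j).
Proof.
rewrite mxE exchange_big; apply: eq_bigr => b _; rewrite mxE big_distrl/=.
by apply: eq_bigr => a _; rewrite mxE; ring.
Qed.

Lemma has_mean_scatter (K : 'M[R]_n) i j :
  has_mean P (fun t => ((E t)^T *m K *m E t) i j) (\tr K * Sig i j).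
Proof.
have := has_mean_sum (index_enum _) (fun a => has_mean_sum (index_enum _)
  (fun b => has_meanZ (K a b) (gaussian_matrix_moment2 a i b j))).
rewrite (_ : \sum_a _ = \tr K * Sig i j).
  by apply: eq_has_mean => t; rewrite scatterE.
rewrite /mxtrace mulr_suml; apply: eq_bigr => a _.
rewrite -[in RHS](sum_delta a (fun b => K a b)) mulr_suml.
by apply: eq_bigr => b _; ring.
Qed.

(** Of the three Isserlis pairings, one yields (tr K)^2 and the other two yield the sum of the
    K_ab^2, which is tr K for a symmetric idempotent. *)
Lemma has_mean_scatter_sqr (K : 'M[R]_n) i j : K^T = K -> K *m K = K ->
  has_mean P (fun t => ((E t)^T *m K *m E t) i j ^+ 2)
    (\tr K ^+ 2 * Sig i j ^+ 2 + \tr K * (Sig i i * Sig j j + Sig i j ^+ 2)).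
Proof.
move=> symK idK.
have := has_mean_sum (index_enum _) (fun a => has_mean_sum (index_enum _)
  (fun b => has_mean_sum (index_enum _) (fun c => has_mean_sum (index_enum _)
  (fun d => has_meanZ (K a b * K c d) (gaussian_matrix_moment4 a i b j c i d j))))).
rewrite (_ : \sum_a _ = \tr K ^+ 2 * Sig i j ^+ 2 +
    \tr K * (Sig i i * Sig j j + Sig i j ^+ 2)).
  apply: eq_has_mean => t; rewrite scatterE expr2 big_distrl/=.
  apply: eq_bigr => a _; rewrite big_distrl/=.
  apply: eq_bigr => b _; rewrite big_distrr/=.
  apply: eq_bigr => c _; rewrite big_distrr/=.
  by apply: eq_bigr => d _; ring.
have symS k l : Sig k l = Sig l k by rewrite -[in LHS]symSig mxE.
have KC a b : K a b = K b a by rewrite -[in LHS]symK mxE.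
have trK : \sum_a \sum_b K a b * K a b = \tr K.
  rewrite -[in RHS]idK /mxtrace; apply: eq_bigr => a _; rewrite mxE.
  by apply: eq_bigr => b _; rewrite (KC b a).
pose s := Sig i j ^+ 2.
transitivity (\sum_a \sum_b (K a b * (a == b)%:R * (\tr K * s) +
    K a b * K a b * (Sig i i * Sig j j + s))).
  apply: eq_bigr => a _; apply: eq_bigr => b _.
  transitivity (\sum_c \sum_d (K c d * (c == d)%:R * (K a b * (a == b)%:R * s)
    + K c d * (b == d)%:R * (K a b * (a == c)%:R * (Sig i i * Sig j j))
    + K c d * (a == d)%:R * (K a b * (b == c)%:R * s))).
    by apply: eq_bigr => c _; apply: eq_bigr => d _; rewrite /s (symS j i); ring.
  under eq_bigr do rewrite !big_split/= -!mulr_suml !sum_delta.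
  rewrite !big_split/= -mulr_suml -/(\tr K).
  rewrite (eq_bigr (fun c => K c b * (a == c)%:R *
    (K a b * (Sig i i * Sig j j)))); last by move=> *; ring.
  rewrite [X in _ + _ + X](eq_bigr (fun c => K c a * (b == c)%:R * (K a b * s)));
    last by move=> *; ring.
  by rewrite -!mulr_suml !sum_delta (KC b a); ring.
under eq_bigr do rewrite big_split/= -!mulr_suml sum_delta.
by rewrite big_split/= -!mulr_suml trK -/(\tr K) -/s; ring.
Qed.

(** Sum of the entrywise variances tr K (Sig_ii Sig_jj + Sig_ij^2). *)
Lemma has_mean_frob2_scatter_dev (K : 'M[R]_n) : K^T = K -> K *m K = K ->
  has_mean P (fun t => frob2 (scatter_dev K t))
    (\tr K * (\tr Sig ^+ 2 + frob2 Sig)).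
Proof.
move=> symK idK.
have h i j := has_meanD (has_meanD (has_mean_scatter_sqr i j symK idK)
  (has_meanZ (- 2 * (\tr K * Sig i j)) (has_mean_scatter K i j)))
  (has_mean_cst P ((\tr K * Sig i j) ^+ 2)).
have := has_mean_sum (index_enum _) (fun i => has_mean_sum (index_enum _) (h i)).
rewrite (_ : \sum_i _ = \tr K * (\tr Sig ^+ 2 + frob2 Sig)).
  apply: eq_has_mean => t; apply: eq_bigr => i _; apply: eq_bigr => j _.
  have subE (A B : 'M[R]_p) c : (A - c *: B) i j = A i j - c * B i j.
    by rewrite !mxE.
  by rewrite /scatter_dev subE; ring.
have -> : \tr Sig ^+ 2 = \sum_i \sum_j Sig i i * Sig j j.
  by rewrite expr2 {1}/mxtrace mulr_suml; apply: eq_bigr => i _; rewrite -mulr_sumr.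
rewrite /frob2 -big_split/= mulr_sumr; apply: eq_bigr => i _.
rewrite -big_split/= mulr_sumr; apply: eq_bigr => j _; ring.
Qed.

End gaussian_matrix.

(** * The regression model *)

Section hat_matrix.
Context {R : realType} (n q : nat) (X : 'M[R]_(n, q)).
Hypotheses (rX : \rank X = q).

Let H := hatmx X.
Let J : 'M[R]_n := n%:R^-1 *: (ones R n *m (ones R n)^T).

(** If v X'X = 0 then |X v'|^2 = 0, and full column rank forces v = 0. *)
Lemma gram_unitmx : X^T *m X \in unitmx.
Proof.
rewrite -row_free_unit; apply: inj_row_free => v v0.
have : X *m v^T = 0.
  apply: enorm_eq0; apply/eqP; rewrite -sqrf_eq0 sqr_enorm trmx_mul trmxK.
  by rewrite mulmxA -(mulmxA v) v0 mul0mx mxE.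
move=> /(congr1 trmx); rewrite trmx_mul trmxK trmx0 => /eqP.
by rewrite mulmx_free_eq0 => [/eqP//|]; rewrite /row_free mxrank_tr rX.
Qed.

Lemma hatmx_sym : H^T = H.
Proof. by rewrite /H /hatmx !trmx_mul trmxK trmx_inv trmx_mul trmxK mulmxA. Qed.

Lemma hatmx_mul : H *m X = X.
Proof. by rewrite /H /hatmx -mulmxA -mulmxA mulVmx ?gram_unitmx// mulmx1. Qed.

Lemma hatmx_idem : H *m H = H.
Proof. by rewrite {2}/H /hatmx !mulmxA hatmx_mul. Qed.

Lemma hatmx_tr : \tr H = q%:R.
Proof.
by rewrite /H /hatmx -mulmxA mxtrace_mulC -mulmxA mulVmx ?gram_unitmx// mxtrace1.
Qed.

Hypotheses (n0 : (0 < n)%N) (X1 : X^T *m ones R n = 0).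

Lemma hatmx_ones : H *m ones R n = 0.
Proof. by rewrite /H /hatmx -mulmxA X1 mulmx0. Qed.

Let M : 'M[R]_n := 1%:M - J - H.

Let symJ : J^T = J.
Proof. by rewrite /J linearZ/= trmx_mul trmxK. Qed.

Let Jones : J *m ones R n = ones R n.
Proof.
rewrite /J -scalemxAl -mulmxA (_ : (ones R n)^T *m ones R n = n%:R%:M).
  by rewrite mul_mx_scalar scalerA mulVf ?scale1r// pnatr_eq0 -lt0n.
apply/matrixP => i j; rewrite !ord1 !mxE.
under eq_bigr do rewrite !mxE mulr1.
by rewrite sumr_const card_ord.
Qed.

Let JX : J *m X = 0.
Proof.
rewrite /J -scalemxAl -mulmxA (_ : _ *m X = 0) ?mulmx0 ?scaler0//.
by rewrite -[LHS]trmxK trmx_mul trmxK X1 trmx0.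
Qed.

Lemma resmx_sym : M^T = M.
Proof. by rewrite /M !linearB/= trmx1 symJ hatmx_sym. Qed.

Lemma resmx_mul : M *m X = 0.
Proof. by rewrite /M !mulmxBl mul1mx JX hatmx_mul subr0 subrr. Qed.

Lemma resmx_ones : M *m ones R n = 0.
Proof. by rewrite /M !mulmxBl mul1mx Jones hatmx_ones subrr subr0. Qed.

Lemma resmx_idem : M *m M = M.
Proof.
rewrite {2}/M !mulmxBr mulmx1 /J -scalemxAr mulmxA resmx_ones mul0mx scaler0 subr0.
by rewrite /H /hatmx !mulmxA resmx_mul !mul0mx subr0.
Qed.

Lemma resmx_tr : \tr M = n%:R - 1 - q%:R.
Proof.
rewrite /M !linearB/= mxtrace1 hatmx_tr /J linearZ/= mxtrace_mulC.
rewrite (_ : (ones R n)^T *m ones R n = n%:R%:M).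
  by rewrite mxtrace_scalar mulr1n mulVf// pnatr_eq0 -lt0n.
apply/matrixP => i j; rewrite !ord1 !mxE.
under eq_bigr do rewrite !mxE mulr1.
by rewrite sumr_const card_ord.
Qed.

End hat_matrix.

(** As a Gram matrix, the sandwich lets the projection act first on the data, where it kills or
    fixes the mean terms. *)
Lemma proj_sandwich (R : realType) n p (M : 'M[R]_n) (Z : 'M[R]_(n, p)) :
  M^T = M -> M *m M = M -> Z^T *m M *m Z = (M *m Z)^T *m (M *m Z).
Proof. by move=> symM idM; rewrite trmx_mul symM !mulmxA -(mulmxA _ M M) idM. Qed.

Lemma trmx_sandwich (R : realType) n p (M : 'M[R]_n) (Z : 'M[R]_(n, p)) :
  M^T = M -> (Z^T *m M *m Z)^T = Z^T *m M *m Z.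
Proof. by move=> symM; rewrite !trmx_mul trmxK symM mulmxA. Qed.

Section decomposition.
Context {R : realType} (n p q : nat) (X : 'M[R]_(n, q)).
Variables (mu g : 'cV[R]_p) (alpha : 'cV[R]_q) (E Y : 'M[R]_(n, p)).
Hypotheses (n0 : (0 < n)%N) (rX : \rank X = q) (X1 : X^T *m ones R n = 0).
Hypothesis (YE : Y = ones R n *m mu^T + X *m alpha *m g^T + E).

Let u := E^T *m (X *m alpha).

(** The hat matrix kills the intercept and fixes [X *m alpha]; expanding the Gram matrix of what
    remains gives signal, cross terms and scatter. *)
Lemma SRE : SR X Y = enorm (X *m alpha) ^+ 2 *: (g *m g^T) +
  (g *m u^T + u *m g^T) + E^T *m hatmx X *m E.
Proof.
have HY : hatmx X *m Y = X *m alpha *m g^T + hatmx X *m E.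
  by rewrite YE !mulmxDr !mulmxA hatmx_ones// mul0mx add0r hatmx_mul.
have symH := hatmx_sym X; have idH := hatmx_idem rX.
have Hx : hatmx X *m (X *m alpha) = X *m alpha by rewrite mulmxA hatmx_mul.
rewrite /SR proj_sandwich// HY proj_sandwich// /u.
move: (hatmx X) (X *m alpha) symH idH Hx => H x symH idH Hx.
have xH : x^T *m H = x^T by rewrite -[in RHS]Hx trmx_mul symH.
rewrite [(_ + _)^T]raddfD/= !trmx_mul !trmxK symH !mulmxDl !mulmxDr -!addrA.
congr (_ + _).
  rewrite -(mulmxA g) (mulmxA x^T) [x^T *m x]mx11_scalar -sqr_enorm.
  by rewrite mul_scalar_mx -scalemxAr.
rewrite !addrA; congr (_ + _ + _).
  by rewrite -mulmxA (mulmxA x^T) xH.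
by rewrite -!mulmxA (mulmxA H) Hx.
Qed.

Lemma SEE : SE X Y =
  E^T *m (1%:M - n%:R^-1 *: (ones R n *m (ones R n)^T) - hatmx X) *m E.
Proof.
rewrite /SE; set M := _ - hatmx X.
have symM : M^T = M by exact: resmx_sym.
have idM : M *m M = M by exact: resmx_idem.
have MY : M *m Y = M *m E.
  by rewrite YE !mulmxDr !mulmxA resmx_ones// resmx_mul// !mul0mx !add0r.
by rewrite !proj_sandwich// MY.
Qed.

End decomposition.

(** * Error probability in a single model *)

Section one_model.
Context dT (T : measurableType dT) {R : realType} (P : probability T R).
Variables (n p q : nat) (w : R) (X : 'M[R]_(n, q)).
Variables (mu g : 'cV[R]_p) (alpha : 'cV[R]_q) (Sig : 'M[R]_p) (s : seq R).
Variables (E Y : T -> 'M[R]_(n, p)) (h : T -> 'cV[R]_p).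
Hypotheses (hw : 0 <= w <= 1) (n_gt : (1 + q < n)%N) (rX : \rank X = q)
  (X1 : X^T *m ones R n = 0) (pdSig : posdefmx Sig) (specSig : spectrum Sig s)
  (g1 : enorm g = 1) (Sg : Sig *m g = s`_0 *: g)
  (gE : gaussian_vector P (fun t => vec (E t)) 0 (Sig *t 1%:M))
  (YE : forall t, Y t = ones R n *m mu^T + X *m alpha *m g^T + E t)
  (mh : forall i, measurable_fun setT (fun t => h t i 0))
  (hh : forall t, first_eigenvector (Sw w X (Y t)) (h t)).

Let n0 : (0 < n)%N. Proof. exact: leq_trans n_gt. Qed.
Let H := hatmx X.
Let M : 'M[R]_n := 1%:M - n%:R^-1 *: (ones R n *m (ones R n)^T) - H.
Let x := X *m alpha.
Let m : R := n%:R - 1 - q%:R.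
Let a := (1 - w) * enorm x ^+ 2.
Let b := (1 - w) * q%:R + w * m.

Let w0 : 0 <= w. Proof. by case/andP: hw. Qed.
Let w1 : 0 <= 1 - w. Proof. by case/andP: hw; rewrite subr_ge0. Qed.
Let symSig : Sig^T = Sig. Proof. by case: pdSig. Qed.
Let psdSig v : 0 <= qform Sig v.
Proof.
have [->|/(proj2 pdSig)/ltW//] := eqVneq v 0.
by rewrite /qform mulmx0 mxE.
Qed.

Let m0 : 0 <= m.
Proof. by rewrite /m -addrA -opprD subr_ge0 -[1 + _]/(1%:R + q%:R) -natrD ler_nat ltnW. Qed.

Let symM : M^T = M. Proof. exact: resmx_sym. Qed.
Let idM : M *m M = M. Proof. exact: resmx_idem. Qed.

Let dev := scatter_dev E Sig.
Let u t := (E t)^T *m x.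
Let N t : 'M[R]_p := (1 - w) *: (g *m (u t)^T + u t *m g^T) + (1 - w) *: dev H t
  + w *: dev M t.

Let SwE t : Sw w X (Y t) = a *: (g *m g^T) + b *: Sig + N t.
Proof.
rewrite /Sw (SRE rX X1 (YE t)) (SEE n0 rX X1 (YE t)) -/H -/M /N /dev /scatter_dev.
rewrite hatmx_tr// resmx_tr// -/m -/x -/(u t) /a /b.
set A := g *m _; set B := g *m _ + _; set C := _ *m H *m _; set D := _ *m M *m _.
by apply/matrixP => i j; rewrite !mxE; ring.
Qed.

Let SwT t : (Sw w X (Y t))^T = Sw w X (Y t).
Proof.
rewrite /Sw linearD/= [(_ *: SR _ _)^T]linearZ [(_ *: SE _ _)^T]linearZ/=.
by rewrite /SR /SE !trmx_sandwich// hatmx_sym.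
Qed.

(** A majorant of [frob2 (N t)] with computable mean: 3 comes from splitting into three summands, 4
    from the symmetrized cross term. *)
Let G t := 3 * ((1 - w) ^+ 2 * (4 * \tr ((E t)^T *m (x *m x^T) *m E t))
   + (1 - w) ^+ 2 * frob2 (dev H t) + w ^+ 2 * frob2 (dev M t)).

Let frob2_N t : frob2 (N t) <= G t.
Proof.
rewrite /N /G; apply: (le_trans (frob2D3 _ _ _)); rewrite ler_pM2l//.
rewrite !frob2Z lerD2r lerD2r ler_wpM2l ?sqr_ge0//.
apply: (le_trans (frob2_sym_outer _ g1)); rewrite ler_pM2l//.
rewrite (_ : _ *m E t = u t *m (u t)^T); last first.
  by rewrite (_ : (u t)^T = x^T *m E t) ?[LHS]trmx_mul ?trmxK// /u !mulmxA.
by rewrite mxtrace_mulC /mxtrace big_ord1 -sqr_enorm.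
Qed.

(** The factors 2 come from bounding [frob2 Sig] by [\tr Sig ^+ 2]; the overall factor 3 of [G] is
    left out. *)
Definition noise_level := (1 - w) ^+ 2 * (4 * (enorm x ^+ 2 * \tr Sig))
  + (1 - w) ^+ 2 * (q%:R * (2 * \tr Sig ^+ 2)) + w ^+ 2 * (m * (2 * \tr Sig ^+ 2)).

Let has_mean_G : exists2 v, has_mean P G v & v <= 3 * noise_level.
Proof.
have hx := has_mean_trmx_mul gE symSig psdSig (x *m x^T).
have hH := has_mean_frob2_scatter_dev gE symSig psdSig (hatmx_sym X) (hatmx_idem rX).
have hM := has_mean_frob2_scatter_dev gE symSig psdSig symM idM.
rewrite -/H -/M in hH hM.
have := has_meanZ 3 (has_meanD (has_meanD (has_meanZ ((1 - w) ^+ 2) (has_meanZ 4 hx))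
  (has_meanZ ((1 - w) ^+ 2) hH)) (has_meanZ (w ^+ 2) hM)).
move=> hG; eexists; first exact: hG.
have F := frob2_posdef_le pdSig.
rewrite ler_pM2l// /noise_level hatmx_tr// resmx_tr// -/m.
rewrite (_ : \tr (x *m x^T) = enorm x ^+ 2); last first.
  by rewrite mxtrace_mulC /mxtrace big_ord1 -sqr_enorm.
by rewrite !lerD// ler_wpM2l ?sqr_ge0// ler_wpM2l//; lra.
Qed.

Let gap := a + b * (s`_0 - s`_1).
Let dist t := Num.min (enorm (1 *: h t - g)) (enorm ((-1) *: h t - g)).

Let measurable_dist : measurable_fun setT dist.
Proof.
have me c : measurable_fun setT (fun t => enorm (c *: h t - g)).
  rewrite /enorm; apply: measurableT_comp.
    by apply: continuous_measurable_fun; exact: sqrt_continuous.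
  apply: (@measurable_sum _ _ _ _ _ _ (fun i t => (c *: h t - g) i 0 ^+ 2)) => i.
  apply: measurable_funX; under eq_fun do rewrite !mxE.
  by apply: measurable_funB => //; exact: measurable_funM.
by apply: measurable_minr.
Qed.

Lemma prob_dist_le (eps : R) : 0 < eps -> 0 < gap ->
  (P [set t | eps < `|dist t - 0|]%R <=
   (48 / eps ^+ 4 * (noise_level / gap ^+ 2))%:E)%E.
Proof.
move=> e0 gap0.
have b0 : 0 <= b by rewrite /b addr_ge0// mulr_ge0.
have [v hG vle] := has_mean_G.
have d0 t : 0 <= dist t by rewrite /dist le_min !enorm_ge0.
(* By the perturbation bound, a distance above [eps] forces [G] above [lev]. Markov's inequality for
   [G] then gives the constant 48 = 16 * 3. *)
pose lev := eps ^+ 4 * gap ^+ 2 / 16.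
have lev0 : 0 < lev by rewrite divr_gt0// mulr_gt0// exprn_gt0.
have G0 t : 0 <= G t by exact: le_trans (frob2_ge0 _) (frob2_N t).
apply: (@le_trans _ _ (P [set t | (lev < G t)%R])).
  apply: le_measure; rewrite ?inE.
  - apply: measurable_gt_fun; apply: measurableT_comp => //.
    exact: measurable_funB.
  - by apply: measurable_gt_fun; exact: has_mean_measurable hG.
  move=> t /=; rewrite subr0 ger0_norm// => et.
  have := spiked_min_enorm_le symSig specSig g1 Sg b0 (ltW gap0) (SwE t) (SwT t) (hh t).
  rewrite -/gap -/(dist t) => hd.
  have e4 : eps ^+ 4 < dist t ^+ 4 by rewrite ltr_pXn2r// nnegrE ?d0// ltW.
  have := frob2_N t; have : eps ^+ 4 * gap ^+ 2 < dist t ^+ 4 * gap ^+ 2.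
    by rewrite ltr_pM2r// exprn_gt0.
  by rewrite /lev; lra.
apply: (le_trans (has_mean_markov G0 hG lev0)); rewrite lee_fin.
rewrite ler_pdivrMr// /lev (le_trans vle)//.
rewrite le_eqVlt; apply/orP; left; apply/eqP; field.
by rewrite !gt_eqF.
Qed.

End one_model.

(** * Asymptotics *)

Section asymptotics.
Context {R : realType}.
Implicit Types (x y u : nat -> R).

(** If every tail infimum were nonpositive, so would be their limit; a positive tail infimum is the
    constant sought. *)
Lemma limn_einf_gt0 u : (0 < limn_einf (fun k => (u k)%:E))%E ->
  exists2 c, 0 < c & \forall k \near \oo, c <= u k.
Proof.
rewrite limn_einf_lim => u0.
have [N uN] : exists N, (0 < einfs (fun k => (u k)%:E) N)%E.
  apply: contrapT => /forallNP h; move: u0; rewrite ltNge => /negP; apply.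
  apply: lime_le; first exact: is_cvg_einfs.
  by apply: nearW => k; rewrite leNgt; apply/negP; exact: h.
have ub k : (N <= k)%N -> (einfs (fun k => (u k)%:E) N <= (u k)%:E)%E.
  by move=> Nk; apply: ereal_inf_lbound; exists k.
case E : (einfs _ N) uN ub => [c| |]//; last first.
  by move=> _ /(_ N (leqnn N)).
rewrite lte_fin => c0 ub; exists c => //.
by exists N => // k /= /ub; rewrite lee_fin.
Qed.

Lemma limn_esup_lty u : (limn_esup (fun k => (u k)%:E) < +oo)%E ->
  exists2 C, 0 < C & \forall k \near \oo, u k <= C.
Proof.
rewrite limn_esup_lim => u0.
have [N uN] : exists N, (esups (fun k => (u k)%:E) N < +oo)%E.
  apply: contrapT => /forallNP h; move: u0; rewrite ltNge => /negP; apply.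
  apply: lime_ge; first exact: is_cvg_esups.
  by apply: nearW => k; rewrite leNgt; apply/negP; exact: h.
have ub k : (N <= k)%N -> ((u k)%:E <= esups (fun k => (u k)%:E) N)%E.
  by move=> Nk; apply: ereal_sup_ubound; exists k.
case E : (esups _ N) uN ub => [c| |]//; last first.
  by move=> _ /(_ N (leqnn N)).
(* The maximum with 1 makes the constant positive. *)
move=> _ ub; exists (Num.max c 1); first by rewrite lt_max ltr01 orbT.
by exists N => // k /= /ub; rewrite lee_fin le_max => ->.
Qed.

Lemma Theta_bounds x y : (forall k, 0 < y k) -> Theta x y ->
  exists c C, [/\ 0 < c, 0 < C &
    \forall k \near \oo, c * y k <= x k <= C * y k].
Proof.
move=> y0 [/limn_einf_gt0[c c0 hc] /limn_esup_lty[C C0 hC]].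
exists c, C; split => //; near=> k.
by apply/andP; split; [rewrite -ler_pdivlMr//|rewrite -ler_pdivrMr//]; near: k.
Unshelve. all: by end_near. Qed.

Lemma cvg_powRN (p : nat -> nat) (a : R) : p @ \oo --> \oo -> a < 0 ->
  (fun k => (p k)%:R `^ a) @ \oo --> 0.
Proof.
move=> p_oo a0; apply/cvgrPdist_lt => e e0.
(* The threshold solves t^a = e; as a < 0, larger t gives a smaller power. *)
have p_big : \forall k \near \oo, e `^ (a^-1) < (p k)%:R.
  near=> k; apply: (lt_le_trans (truncnS_gt _)); rewrite ler_nat; near: k.
  by move/cvgnyPge : p_oo; apply.
near=> k; rewrite sub0r normrN ger0_norm ?powR_ge0//.
have pk : e `^ (a^-1) < (p k)%:R by near: k.
have e1 : 0 < e `^ (a^-1) by rewrite powR_gt0.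
rewrite -[a]opprK powRN -[ltRHS]invrK ltf_pV2 ?posrE ?invr_gt0 ?powR_gt0//; last first.
  exact: lt_trans pk.
have -> : e^-1 = (e `^ (a^-1)) `^ (- a).
  by rewrite -powRrM mulrN mulVf ?lt_eqF// powR_inv1// ltW.
by apply: gt0_ltr_powR; rewrite ?oppr_gt0 ?nnegrE// ltW// (lt_trans e1).
Unshelve. all: by end_near. Qed.

(** The quotient is at most A / c^2 times p^(e - 2f), so only the exponents have to be compared. *)
Lemma cvg_div_powR (p : nat -> nat) (e f A c : R) x y : (forall k, (0 < p k)%N) ->
  p @ \oo --> \oo -> 0 < c -> e < 2 * f ->
  (\forall k \near \oo, 0 <= x k <= A * (p k)%:R `^ e) ->
  (\forall k \near \oo, c * (p k)%:R `^ f <= y k) ->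
  (fun k => x k / y k ^+ 2) @ \oo --> 0.
Proof.
move=> p0 p_oo c0 ef hx hy.
have : (fun k => A / c ^+ 2 * (p k)%:R `^ (e - 2 * f)) @ \oo --> 0.
  rewrite -[X in _ --> X](mulr0 (A / c ^+ 2)); apply: cvgM; first exact: cvg_cst.
  by apply: cvg_powRN => //; lra.
apply: (@squeeze_cvgr _ _ _ _ (fun=> 0)); last exact: cvg_cst.
near=> k; have pk : 0 < (p k)%:R :> R by rewrite ltr0n.
have /andP[x0 xA] : 0 <= x k <= A * (p k)%:R `^ e by near: k.
have yc : c * (p k)%:R `^ f <= y k by near: k.
have y0 : 0 < c * (p k)%:R `^ f by rewrite mulr_gt0// powR_gt0.
rewrite divr_ge0 ?sqr_ge0//=.
rewrite ler_pdivrMr ?exprn_gt0 ?(lt_le_trans y0)//.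
apply: (le_trans xA).
have A0 : 0 <= A by have := le_trans x0 xA; rewrite pmulr_lge0 ?powR_gt0.
have -> : A * (p k)%:R `^ e =
    A / c ^+ 2 * (p k)%:R `^ (e - 2 * f) * (c * (p k)%:R `^ f) ^+ 2.
  have -> : (p k)%:R `^ e = (p k)%:R `^ (e - 2 * f) * (p k)%:R `^ f ^+ 2.
    rewrite -powR_mulrn ?powR_ge0// -powRrM -powRD; last first.
      by apply/implyP => _; rewrite gt_eqF.
    by congr (_ `^ _); ring.
  by field; rewrite gt_eqF.
rewrite ler_wpM2l ?mulr_ge0 ?powR_ge0 ?invr_ge0 ?sqr_ge0//.
by rewrite ler_pXn2r ?nnegrE// ltW// (lt_le_trans y0).
Unshelve. all: by end_near. Qed.

End asymptotics.

Local Ltac nonneg := repeat first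
  [ done | exact: ltW | exact: sqr_ge0 | exact: powR_ge0
  | apply: addr_ge0 | apply: mulr_ge0 ].

Theorem theorem5p1 (R : realType) (q : nat) (hq : (0 < q)%N)
  (w : R) (hw : 0 <= w <= 1)
  (delta beta : R) (hdelta : 0 < delta) (hbeta : beta <= 1)
  (* the sequence of models *)
  (n p : nat -> nat)
  (hp : forall k, (2 <= p k)%N) (hn : forall k, (1 + q < n k)%N)
  (X : forall k, 'M[R]_(n k, q))
  (hXrank : forall k, \rank (X k) = q)
  (hXones : forall k, (X k)^T *m ones R (n k) = 0)
  (mu : forall k, 'cV[R]_(p k)) (alpha : nat -> 'cV[R]_q)
  (Sigma : forall k, 'M[R]_(p k)) (hSigma : forall k, posdefmx (Sigma k))
  (lambda : nat -> seq R)
  (hlambda : forall k, spectrum (Sigma k) (lambda k))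
  (hgap : forall k, (lambda k)`_1 < (lambda k)`_0)
  (gamma1 : forall k, 'cV[R]_(p k))
  (hgamma1 : forall k, enorm (gamma1 k) = 1 /\
     Sigma k *m gamma1 k = (lambda k)`_0 *: gamma1 k)
  (disp : nat -> measure_display) (Omega : forall k, measurableType (disp k))
  (P : forall k, probability (Omega k) R)
  (E Y : forall k, Omega k -> 'M[R]_(n k, p k))
  (hE : forall k, gaussian_vector (P k) (fun t => vec (E k t)) 0
     (Sigma k *t 1%:M))
  (hY : forall k t, Y k t =
     ones R (n k) *m (mu k)^T + X k *m alpha k *m (gamma1 k)^T + E k t)
  (* the estimator: any measurable choice of a first principal eigenvector *)
  (gammahat : forall k, Omega k -> 'cV[R]_(p k))
  (hgammahat_meas : forall k i,
     measurable_fun [set: Omega k] (fun t => gammahat k t i 0))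
  (hgammahat : forall k t, first_eigenvector (Sw w (X k) (Y k t)) (gammahat k t))
  (* the asymptotic regime *)
  (hn_oo : n @ \oo --> \oo) (hp_oo : p @ \oo --> \oo)
  (c : R) (hc : 0 < c)
  (hnp : (fun k => (n k)%:R / (p k)%:R `^ delta) @ \oo --> c)
  (hsignal : Theta (fun k => enorm (X k *m alpha k) ^+ 2)
     (fun k => (p k)%:R `^ delta))
  (htrace : Theta (fun k => \tr (Sigma k)) (fun k => (p k)%:R))
  (hgapTheta : Theta (fun k => (lambda k)`_0 - (lambda k)`_1)
     (fun k => (p k)%:R `^ beta))
  (hcond : [\/ w = 0 /\ 1 < delta,
               0 < w < 1 /\ Num.min (2 - 2 * beta) 2 < delta
             | w = 1 /\ 2 - 2 * beta < delta]) :
  cvg_in_probability P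
    (fun k t => Num.min (enorm (1 *: gammahat k t - gamma1 k))
                        (enorm ((-1) *: gammahat k t - gamma1 k))) 0.

Proof.
move=> eps eps0.
pose pR k : R := (p k)%:R.
pose s k := enorm (X k *m alpha k) ^+ 2.
pose d k := (lambda k)`_0 - (lambda k)`_1.
pose tau k := \tr (Sigma k).
pose m k : R := (n k)%:R - 1 - q%:R.
pose gap k := (1 - w) * s k + ((1 - w) * q%:R + w * m k) * d k.
pose W k := noise_level w (X k) (alpha k) (Sigma k).
have [w0 w1] : 0 <= w /\ w <= 1 by case/andP: hw.
have w1' : 0 <= 1 - w by rewrite subr_ge0.
have p0 k : (0 < p k)%N by exact: leq_trans (hp k).
have pR1 k : 1 <= pR k by rewrite ler1n.
have pR0 k : 0 < pR k by rewrite ltr0n.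
have [cs [Cs [cs0 Cs0 hs]]] := Theta_bounds (fun k => powR_gt0 delta (pR0 k)) hsignal.
have [ct [Ct [ct0 Ct0 ht]]] := Theta_bounds pR0 htrace.
have [cg [Cg [cg0 Cg0 hg]]] := Theta_bounds (fun k => powR_gt0 beta (pR0 k)) hgapTheta.
(* Eventually n lies between c/2 and 2c times p^delta, and n >= 2(1 + q) gives m >= n/2, hence the
   constant c/4. *)
have hm : \forall k \near \oo, c / 4 * pR k `^ delta <= m k <= 2 * c * pR k `^ delta.
  have n1 : \forall k \near \oo, c / 2 < (n k)%:R / pR k `^ delta.
    by apply: (cvgr_gt _ hnp); lra.
  have n2 : \forall k \near \oo, (n k)%:R / pR k `^ delta < 2 * c.
    by apply: (cvgr_lt _ hnp); lra.
  have n3 : \forall k \near \oo, (2 * (1 + q) <= n k)%N.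
    by move/cvgnyPge : hn_oo; apply.
  near=> k.
  have P0 : 0 < pR k `^ delta by rewrite powR_gt0.
  have : c / 2 * pR k `^ delta < (n k)%:R.
    by rewrite -ltr_pdivlMr//; near: k.
  have : (n k)%:R < 2 * c * pR k `^ delta.
    by rewrite -ltr_pdivrMr//; near: k.
  have : ((2 * (1 + q))%:R <= (n k)%:R :> R) by rewrite ler_nat; near: k.
  rewrite natrM natrD /m; have := ler0n R q; lra.
have d0 k : 0 <= d k by rewrite subr_ge0 ltW.
have s0 k : 0 <= s k by exact: sqr_ge0.
have m0 k : 0 <= m k.
  by rewrite /m -addrA -opprD subr_ge0 -[1 + _]/(1%:R + q%:R) -natrD ler_nat ltnW.
(* The gap has two sources, signal and residual covariance; either alone is a lower bound as all
   terms are nonnegative. *)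
have gap_s k : (1 - w) * s k <= gap k.
  by rewrite /gap lerDl mulr_ge0// addr_ge0// mulr_ge0// subr_ge0.
have gap_m k : w * m k * d k <= gap k.
  rewrite /gap [(_ + w * m k) * _]mulrDl addrA lerDr.
  apply: addr_ge0; first exact: mulr_ge0.
  by apply: mulr_ge0 => //; exact: mulr_ge0.
suff [e [f [A [kap [kap0 ef hW hgap']]]]] : exists e f A kap : R,
    [/\ 0 < kap, e < 2 * f,
      \forall k \near \oo, 0 <= W k <= A * pR k `^ e &
      \forall k \near \oo, kap * pR k `^ f <= gap k].
  have := cvg_div_powR p0 hp_oo kap0 ef hW hgap'.
  move=> /(cvgM (cvg_cst (48 / eps ^+ 4))); rewrite mulr0.
  move=> W_gap.
  apply: (@squeeze_cvge _ _ _ _ (fun=> 0%E) _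
    (fun k => (48 / eps ^+ 4 * (W k / gap k ^+ 2))%:E)).
  - near=> k; rewrite measure_ge0/=.
    have [g1 Sg] := hgamma1 k.
    apply: (prob_dist_le hw (hn k) (hXrank k) (hXones k) (hSigma k) (hlambda k) g1 Sg
      (@hE k) (@hY k) (@hgammahat_meas k) (@hgammahat k) eps0).
    apply: (@lt_le_trans _ _ (kap * pR k `^ f)); first by rewrite mulr_gt0// powR_gt0.
    by near: k.
  - exact: cvg_cst.
  - by apply: cvg_EFin; [exact: nearW|exact: W_gap].
have tau_le : \forall k \near \oo, 0 <= tau k <= Ct * pR k.
  by apply: filterS ht => k /andP[h1 ->]; rewrite andbT (le_trans _ h1)// mulr_ge0// ltW.
have WE k : W k = (1 - w) ^+ 2 * (4 * (s k * tau k)) +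
    (1 - w) ^+ 2 * (q%:R * (2 * tau k ^+ 2)) + w ^+ 2 * (m k * (2 * tau k ^+ 2)).
  by [].
have W0 : \forall k \near \oo, 0 <= W k.
  apply: filterS tau_le => k /andP[t0 _]; rewrite WE.
  by nonneg.
have w2 : w ^+ 2 <= 1 by rewrite expr_le1.
have w2' : (1 - w) ^+ 2 <= 1 by rewrite expr_le1// ?subr_ge0// gerBl.
(* The factor [w ^+ 2] is kept in the last term, so that the dominant order disappears when w =
   0. *)
have W_le : \forall k \near \oo, W k <= 4 * (Cs * Ct * (pR k `^ delta * pR k)) +
    2 * q%:R * (Ct ^+ 2 * pR k ^+ 2) +
    w ^+ 2 * (4 * c * Ct ^+ 2 * (pR k `^ delta * pR k ^+ 2)).
  near=> k.
  have /andP[_ sk] : cs * pR k `^ delta <= s k <= Cs * pR k `^ delta by near: k.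
  have /andP[tk0 tk] : 0 <= tau k <= Ct * pR k by near: k.
  have /andP[_ mk] : c / 4 * pR k `^ delta <= m k <= 2 * c * pR k `^ delta by near: k.
  have t2 : tau k ^+ 2 <= Ct ^+ 2 * pR k ^+ 2.
    by rewrite -exprMn ler_pXn2r ?nnegrE// mulr_ge0// ltW.
  have st : s k * tau k <= Cs * Ct * (pR k `^ delta * pR k).
    by rewrite mulrACA ler_pM.
  have mt : m k * tau k ^+ 2 <= 2 * c * Ct ^+ 2 * (pR k `^ delta * pR k ^+ 2).
    by rewrite mulrACA ler_pM// sqr_ge0.
  rewrite WE; apply: lerD; first apply: lerD.
  - have x0 : 0 <= 4 * (s k * tau k) by nonneg.
    by apply: (le_trans (ler_piMl x0 w2')); rewrite ler_pM2l.
  - have x0 : 0 <= q%:R * (2 * tau k ^+ 2) by nonneg.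
    apply: (le_trans (ler_piMl x0 w2')).
    by rewrite mulrA [q%:R * 2]mulrC ler_wpM2l.
  - by apply: ler_wpM2l; [exact: sqr_ge0|lra].
have powS k : pR k `^ (delta + 1) = pR k `^ delta * pR k.
  by rewrite powRD ?powRr1 ?ltW//; apply/implyP => _; rewrite gt_eqF.
have powSS k : pR k `^ (delta + 2) = pR k `^ delta * pR k ^+ 2.
  by rewrite powRD ?powR_mulrn ?ltW//; apply/implyP => _; rewrite gt_eqF.
(* All three orders are absorbed into p^(delta + 2), since p >= 1 and delta > 0. *)
have W_le2 : \forall k \near \oo, 0 <= W k <=
    (4 * (Cs * Ct) + 2 * q%:R * Ct ^+ 2 + 4 * c * Ct ^+ 2) * pR k `^ (delta + 2).
  apply: filterS2 W0 W_le => k -> /= /le_trans; apply.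
  have P1 : 1 <= pR k `^ delta by rewrite -(powRr0 (pR k)) ler_powR// ltW.
  rewrite powSS [leRHS]mulrDl [(4 * _ + _) * _]mulrDl; apply: lerD; first apply: lerD.
  - rewrite mulrA; apply: ler_wpM2l; first by nonneg.
    by apply: ler_wpM2l; [nonneg|rewrite expr2 ler_peMl// ltW].
  - rewrite mulrA; apply: ler_wpM2l; first by nonneg.
    by apply: ler_peMl => //; nonneg.
  - by apply: ler_piMl => //; nonneg.
have gap_signal : w < 1 -> exists2 kap : R, 0 < kap &
    \forall k \near \oo, kap * pR k `^ delta <= gap k.
  move=> w_lt1; exists ((1 - w) * cs); first by rewrite mulr_gt0// subr_gt0.
  apply: filterS hs => k /andP[h1 _]; apply: le_trans (gap_s k).
  by rewrite -mulrA ler_wpM2l// subr_ge0.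
have gap_noise : 0 < w -> exists2 kap : R, 0 < kap &
    \forall k \near \oo, kap * pR k `^ (delta + beta) <= gap k.
  move=> w_gt0; exists (w * (c / 4) * cg); first by rewrite !mulr_gt0// divr_gt0.
  near=> k; apply: le_trans (gap_m k).
  have /andP[mk _] : c / 4 * pR k `^ delta <= m k <= 2 * c * pR k `^ delta by near: k.
  have /andP[dk _] : cg * pR k `^ beta <= d k <= Cg * pR k `^ beta by near: k.
  rewrite powRD; last by apply/implyP => _; rewrite gt_eqF.
  rewrite mulrACA; apply: ler_pM => //.
  - by nonneg; rewrite divr_ge0// ltW.
  - by nonneg.
  - by rewrite -mulrA ler_wpM2l.
case: hcond => [[w_eq0 delta1]|[/andP[w_gt0 w_lt1]]|[w_eq1 delta2]].
- have /gap_signal[kap kap0 hk] : w < 1 by rewrite w_eq0.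
  (* Here e < 2f reads delta > 1; the same condition gives p^2 <= p^(delta + 1) for the middle
     term. *)
  exists (delta + 1), delta, (4 * (Cs * Ct) + 2 * q%:R * Ct ^+ 2), kap; split => //; first lra.
  apply: filterS2 W0 W_le => k -> /= /le_trans; apply.
  rewrite w_eq0 expr0n/= mul0r addr0 powS [leRHS]mulrDl; apply: lerD; first by rewrite mulrA.
  rewrite mulrA; apply: ler_wpM2l; first by nonneg.
  by rewrite expr2 ler_wpM2r ?le1r_powR// ltW.
(* Whichever term of the minimum lies below delta selects the gap bound: f = delta + beta needs
   delta > 2 - 2 beta, and f = delta needs delta > 2. *)
- rewrite gt_min => /orP[delta2|delta2].
    have [kap kap0 hk] := gap_noise w_gt0.
    by exists (delta + 2), (delta + beta); do 2!eexists; split; eauto; lra.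
  have [kap kap0 hk] := gap_signal w_lt1.
  by exists (delta + 2), delta; do 2!eexists; split; eauto; lra.
- have /gap_noise[kap kap0 hk] : 0 < w by rewrite w_eq1.
  by exists (delta + 2), (delta + beta); do 2!eexists; split; eauto; lra.
Unshelve. all: by end_near. Qed.
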